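(* Suppose there exists a countable Borel equivalence relation $E$ on a standard Borel space which is hyper-hyperfinite but not hyperfinite. Then the hyperfinite countable Borel equivalence relations form a $\mathbf{\Sigma}^1_2$-complete set; that is, for every Polish space $X$ the set of Borel codes $c\in\mathbf{BC}(X\times X)$ which code a hyperfinite countable Borel equivalence relation on $X$ is $\mathbf{\Sigma}^1_2$, and for some Polish space $X$ this set is $\mathbf{\Sigma}^1_2$-hard.
   Context: A countable Borel equivalence relation (CBER) on a standard Borel space $X$ is a Borel equivalence relation $E\subseteq X^2$ all of whose classes are countable. $E$ is hyperfinite if $E=\bigcup_n F_n$ for an increasing sequence $F_0\subseteq F_1\subseteq\dots$ of Borel equivalence relations with finite classes. $E$ is hyper-hyperfinite if $E=\bigcup_n F_n$ for an increasing sequence $F_0\subseteq F_1\subseteq\dots$ of hyperfinite CBERs. Borel sets are coded via a fixed standard coding: for a Polish space $Y$, $\mathbf{BC}(Y)\subseteq\mathbb{N}^\mathbb{N}$ is a $\mathbf{\Pi}^1_1$ set of Borel codes, each $c\in\mathbf{BC}(Y)$ coding a Borel set $\mathbf{A}(Y)_c\subseteq Y$, where $\mathbf{A}(Y)\subseteq\mathbb{N}^\mathbb{N}\times Y$ is analytic, agrees on $\mathbf{BC}(Y)\times Y$ with a coanalytic set, and every Borel subset of $P\times Y$ ($P$ Polish) has its sections coded by a Borel map $P\to\mathbf{BC}(Y)$. A set $A$ in a Polish space $W$ is $\mathbf{\Sigma}^1_2$-hard if for every Polish $V$ and every $\mathbf{\Sigma}^1_2$ set $B\subseteq V$ there is a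 continuous $f:V\to W$ with $f^{-1}(A)=B$; it is $\mathbf{\Sigma}^1_2$-complete if moreover $A\in\mathbf{\Sigma}^1_2$.
   Formalization: Hardness is taken over zero-dimensional Polish V (those with a clopen basis) instead of every Polish V: the codes lie in N^N, continuous maps from the real line to N^N are constant, so no subset of N^N would be hard under the literal definition. *)

(* Defs.v *)
From mathcomp Require Import all_boot all_order all_algebra.
From mathcomp Require Import all_classical all_reals topology measurable_structure.
From Stdlib Require Import RelationClasses.

Set Implicit Arguments.
Unset Strict Implicit.
Unset Printing Implicit Defensive.

Import Order.TTheory GRing.Theory Num.Theory.

Local Open Scope classical_set_scope.
Local Open Scope ring_scope.

Record is_metric (R : realType) (T : Type) (d : T -> T -> R) : Prop := {
  metric_ge0 : forall x y, 0 <= d x y;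
  metric_eq0 : forall x y, d x y = 0 <-> x = y;
  metric_sym : forall x y, d x y = d y x;
  metric_triangle : forall x y z, d x z <= d x y + d y z }.

Definition metric_induces_topology (R : realType) (T : topologicalType)
    (d : T -> T -> R) : Prop :=
  forall (x : T) (A : set T),
    nbhs x A <-> exists2 e : R, 0 < e & [set y | d x y < e] `<=` A.

Definition metric_complete (R : realType) (T : topologicalType)
    (d : T -> T -> R) : Prop :=
  forall u : nat -> T,
    (forall e : R, 0 < e ->
       exists N : nat, forall m n : nat,
         (N <= m)%N -> (N <= n)%N -> d (u m) (u n) < e) ->
    exists l : T, u @ \oo --> l.

Definition separable (T : topologicalType) : Prop :=
  exists2 D : set T, countable D & dense D.

(* The empty space is Polish. The metric is not part of the data. *)
Definition polish (R : realType) (T : topologicalType) : Prop :=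
  separable T /\
  exists d : T -> T -> R,
    [/\ is_metric d, metric_induces_topology d & metric_complete d].

(* Not the library's [zero_dimensional], which only says that clopen sets
   separate points. *)
Definition has_clopen_basis (T : topologicalType) : Prop :=
  basis (@clopen T).

Definition baire : topologicalType := prod_topology (fun _ : nat => nat).

Definition borel (T : topologicalType) : set_system T := <<s @open T >>.

Definition borel_map (T U : topologicalType) (f : T -> U) : Prop :=
  forall B : set U, borel B -> borel (f @^-1` B).

Definition analytic (R : realType) (T : topologicalType) (A : set T) : Prop :=
  exists (Y : topologicalType) (f : Y -> T),
    [/\ polish R Y, continuous f & range f = A].

Definition coanalytic (R : realType) (T : topologicalType) (A : set T) : Prop :=
  analytic R (~` A).

Definition sigma12 (R : realType) (T : topologicalType) (A : set T) : Prop :=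
  exists2 C : set (T * baire)%type, coanalytic R C & A = fst @` C.

(* The source spaces are zero-dimensional, as is standard for hardness under
   continuous reductions: every continuous map from a connected space to
   [baire] is constant, so no subset of [baire] would be hard if all Polish
   spaces were allowed. *)
Definition sigma12_hard (R : realType) (W : topologicalType) (A : set W) : Prop :=
  forall V : topologicalType, polish R V -> has_clopen_basis V ->
  forall B : set V, sigma12 R B ->
  exists2 f : V -> W, continuous f & f @^-1` A = B.

(* A measurable space is a type X with a set system S of measurable sets; the
   library's [measurableType] is not used because it excludes the empty space. *)
Definition standard_borel (R : realType) (X : Type) (S : set_system X) : Prop :=
  exists (Y : topologicalType) (f : X -> Y),
    [/\ polish R Y, bijective f & S = [set f @^-1` B | B in @borel Y]].

Definition prod_salgebra (X : Type) (S : set_system X) : set_system (X * X)%type :=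
  <<s [set A `*` B | A in S & B in S] >>.

Definition borel_equiv (X : Type) (S : set_system X) (E : set (X * X)) : Prop :=
  prod_salgebra S E /\ Equivalence (fun x y : X => E (x, y)).

Definition cber (X : Type) (S : set_system X) (E : set (X * X)) : Prop :=
  borel_equiv S E /\ forall x : X, countable [set y | E (x, y)].

Definition fber (X : Type) (S : set_system X) (E : set (X * X)) : Prop :=
  borel_equiv S E /\ forall x : X, finite_set [set y | E (x, y)].

Definition increasing_union (X : Type) (F : nat -> set (X * X))
    (E : set (X * X)) : Prop :=
  (forall n, F n `<=` F n.+1) /\ E = \bigcup_n F n.

Definition hyperfinite (X : Type) (S : set_system X) (E : set (X * X)) : Prop :=
  exists F : nat -> set (X * X),
    (forall n, fber S (F n)) /\ increasing_union F E.

Definition hyperhyperfinite (X : Type) (S : set_system X)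
    (E : set (X * X)) : Prop :=
  exists F : nat -> set (X * X),
    (forall n, cber S (F n) /\ hyperfinite S (F n)) /\ increasing_union F E.

(* A standard coding of the Borel subsets of all Polish spaces: [BC K Y] is the
   set of codes, and a code c codes the section of [@codedA R K Y] at c. Nothing is
   required when Y is not Polish. *)
Record borel_coding (R : realType) := BorelCoding {
  BC : forall Y : topologicalType, set baire;
  codedA : forall Y : topologicalType, set (baire * Y)%type;
  BC_coanalytic : forall Y, polish R Y -> coanalytic R (BC Y);
  codedA_borel : forall Y, polish R Y ->
    forall c, BC Y c -> borel [set y | @codedA Y (c, y)];
  codedA_analytic : forall Y, polish R Y -> analytic R (@codedA Y);
  codedA_coanalytic : forall Y, polish R Y ->
    exists2 D : set (baire * Y)%type, coanalytic R D &
      forall c y, BC Y c -> (@codedA Y (c, y) <-> D (c, y));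
  codedA_sections : forall Y, polish R Y ->
    forall P : topologicalType, polish R P ->
    forall B : set (P * Y)%type, borel B ->
    exists2 f : P -> baire, borel_map f &
      forall p, BC Y (f p) /\
        [set y | @codedA Y (f p, y)] = [set y | B (p, y)] }.

Definition coded (R : realType) (K : borel_coding R) (Y : topologicalType)
    (c : baire) : set Y := [set y | codedA K (c, y)].

Definition hyperfinite_codes (R : realType) (K : borel_coding R)
    (X : topologicalType) : set baire :=
  [set c | [/\ BC K (X * X)%type c,
               cber (@borel X) (coded K c : set (X * X)%type)
             & hyperfinite (@borel X) (coded K c : set (X * X)%type)]].

(* Main.v *)
Require Import Defs.
From mathcomp Require Import all_boot all_order all_algebra.
From mathcomp Require Import all_classical all_reals topology.
From mathcomp Require Import measurable_structure lra.
From Stdlib Require Import RelationClasses.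

(** Let E be the union of an increasing sequence of hyperfinite relations F_n,
    each an increasing union of finite relations F_n^m, and not hyperfinite. A real
    u determines an increasing sequence of finite relations, of which the k-th
    merges the previous classes lying inside a single F_k^(u k)-class. For every
    point x only finitely many values u k are bad at a given stage; if infinitely
    many stages are good for x then the whole E-class of x is captured. So a tree
    z on the naturals defines a set X_z of points, the x for which z has no branch
    that is eventually bad (a Borel condition, by compactness): X_z is everything
    if z is well founded, and a branch of z makes E hyperfinite on X_z.

    Let p be in a Sigma^1_2 set iff some tree T_(p,w) is well founded. Define E_p
    on pairs (w, x) as E restricted to X_z in the fibre over w, where z = z(p,w) is
    the tree of attempts to find w' and a monotone map from T_(p,w') to r, and r is
    the tree of attempts to refute that w codes a hyperfiniteness witness that is
    correct on the fibre over w. The mutual dependence of z and r is a recursion on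
    levels. If all T_(p,w') are ill founded and w codes a witness for E_p, then r
    is well founded, hence so is z, and E would be hyperfinite. If T_(p,w0) is well
    founded, then Borel in w either it maps into r, giving a branch of z, or r is
    well founded and w itself is correct.

    Sections of Borel sets are coded by maps that are only Borel. The reduction is
    made continuous by using parameters <c, x>, where c codes a Borel map h on
    the parameter space and x is a generic real, computed from the forcing relation
    of c, in which the point to be reduced is written. The forcing relation is the
    only solution of its recursion along c, so decoding it is Sigma^1_2, while h is
    continuous on generics. *)

Set Implicit Arguments.
Unset Strict Implicit.
Unset Printing Implicit Defensive.

Import Order.TTheory GRing.Theory Num.Theory.

Local Open Scope classical_set_scope.

(** * Baire space *)

Definition pre (x : baire) (n : nat) : seq nat := mkseq x n.

Lemma size_pre x n : size (pre x n) = n.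
Proof. exact: size_mkseq. Qed.

Lemma preP x y n : pre x n = pre y n <-> (forall i, i < n -> x i = y i).
Proof.
split=> [e i ltin|e].
  by rewrite -(nth_mkseq 0 x ltin) -(nth_mkseq 0 y ltin) [mkseq x n]e.
apply: (@eq_from_nth _ 0); rewrite !size_pre // => i ltin.
by rewrite !nth_mkseq // e.
Qed.

Lemma pre_le x y m n : m <= n -> pre x n = pre y n -> pre x m = pre y m.
Proof.
by move=> lemn /preP e; apply/preP => i /leq_trans ltim; apply: e; exact: ltim.
Qed.

Lemma preS x n : pre x n.+1 = rcons (pre x n) (x n).
Proof. by rewrite /pre mkseqS. Qed.

Lemma take_pre x m n : m <= n -> take m (pre x n) = pre x m.
Proof. by move=> lemn; rewrite /pre /mkseq -map_take take_iota (minn_idPl lemn). Qed.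

Lemma pre_nth (s : seq nat) : pre (nth 0 s) (size s) = s.
Proof. exact: mkseq_nth. Qed.

(** The product topology is a supremum of initial topologies, so convergence of the filter of prefix
    cylinders is checked one coordinate at a time; conversely a cylinder is a finite intersection of
    coordinate conditions. *)
Lemma nbhs_baire (x : baire) (A : set baire) :
  nbhs x A <-> exists n, forall y, pre y n = pre x n -> A y.
Proof.
split=> [nA|[n nA]].
  pose F := filter_from [set: nat] (fun n => [set y : baire | pre y n = pre x n]).
  have FF : Filter F.
    apply: filter_from_filter; first by exists 0.
    move=> i j _ _; exists (maxn i j) => // y /= e; split => /=;
      by apply: pre_le e; rewrite (leq_maxl, leq_maxr).
  have Fx : F --> x.
    apply/cvg_sup => i U [V] [[W] oW <-] WfN WU.
    exists i.+1 => // y /preP e; apply: WU => /=; rewrite e //.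
  by have [n _ h] := Fx _ nA; exists n => y; exact: h.
suff : nbhs x [set y : baire | forall i, i < n -> y i = x i].
  by apply: filterS => y /= e; apply: nA; exact/preP.
elim: n {nA} => [|n IH]; first by apply: filterS filterT.
have cn : nbhs x [set y : baire | y n = x n].
  have /(_ [set x n]) := @proj_continuous nat (fun _ => nat) n x; apply.
  exact: (@discrete_set1 nat (x n)).
apply: filterS (filterI IH cn) => y /= [e en] i.
by rewrite ltnS leq_eqVlt => /orP[/eqP->|] //; exact: e.
Qed.

Lemma continuous_to_baire (T : topologicalType) (f : T -> baire) :
  (forall i t, nbhs t [set t' | f t' i = f t i]) -> continuous f.
Proof.
move=> cf t A /nbhs_baire[n nA].
suff : nbhs t [set t' | forall i, i < n -> f t' i = f t i].
  by apply: filterS => t' /= e; apply: nA; exact/preP.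
elim: n {nA} => [|n IH]; first by apply: filterS filterT.
apply: filterS (filterI IH (cf n t)) => t' /= [e en] i.
by rewrite ltnS leq_eqVlt => /orP[/eqP->|] //; exact: e.
Qed.

Lemma continuous_coord (T : topologicalType) (f : T -> baire) i t :
  {for t, continuous f} -> nbhs t [set t' | f t' i = f t i].
Proof.
move=> /(_ [set y : baire | y i = f t i]); apply.
by apply/nbhs_baire; exists i.+1 => y /preP; apply.
Qed.

Lemma continuous_from_baire (T : topologicalType) (f : baire -> T) x A :
  {for x, continuous f} -> nbhs (f x) A ->
  exists n, forall y, pre y n = pre x n -> A (f y).
Proof. by move=> cf /cf/nbhs_baire. Qed.

Lemma open_coord (T : topologicalType) (f : T -> baire) i (D : set nat) :
  continuous f -> open [set t | D (f t i)].
Proof.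
move=> cf; rewrite openE => t Dt.
by apply: filterS (continuous_coord i (cf t)) => t' /= ->.
Qed.

Lemma open_pre (T : topologicalType) (f : T -> baire) n (D : set (seq nat)) :
  continuous f -> open [set t | D (pre (f t) n)].
Proof.
move=> cf; rewrite openE => t Dt.
have /(_ [set y | D (pre y n)]) := cf t; apply.
by apply/nbhs_baire; exists n => y /= ->.
Qed.

Lemma hausdorff_baire : hausdorff_space baire.
Proof.
apply: (@hausdorff_product nat (fun _ => nat)) => _.
exact: discrete_hausdorff.
Qed.

(** * Borel sets *)

Section borel_calculus.
Variable T : topologicalType.
Implicit Types A B : set T.

Lemma borel_open A : open A -> borel A.
Proof. by move=> oA; exact: sub_sigma_algebra. Qed.

Lemma borelC A : borel A -> borel (~` A).
Proof. by move=> bA; rewrite -setTD; exact: sigma_algebraCD. Qed.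

Lemma borel_closed A : closed A -> borel A.
Proof. by move=> cA; rewrite -(setCK A); apply: borelC; apply: borel_open; exact: closed_openC. Qed.

Lemma borel_bigcup (A : nat -> set T) : (forall n, borel (A n)) -> borel (\bigcup_n A n).
Proof. exact: sigma_algebra_bigcup. Qed.

Lemma borel_cst (P : Prop) : borel [set _ : T | P].
Proof.
have [p|np] := pselect P.
  by rewrite (_ : mkset _ = setT); [apply: borel_open; exact: openT|apply/seteqP; split].
by rewrite (_ : mkset _ = set0); [apply: borel_open; exact: open0|apply/seteqP; split].
Qed.

Lemma borel_ex (I : countType) (P : I -> T -> Prop) :
  (forall i, borel [set x | P i x]) -> borel [set x | exists i, P i x].
Proof.
move=> bP.
rewrite (_ : mkset _ =
  \bigcup_n [set x | if @unpickle I n is Some i then P i x else False]).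
  by apply: borel_bigcup => n; case: unpickle => [i|]; [exact: bP|exact: borel_cst].
apply/seteqP; split => [x [i Pix]|x [n _ /=]]; last by case: unpickle => // i; exists i.
by exists (pickle i) => //=; rewrite pickleK.
Qed.

Lemma borel_not (P : T -> Prop) : borel [set x | P x] -> borel [set x | ~ P x].
Proof. exact: borelC. Qed.

Lemma borel_all (I : countType) (P : I -> T -> Prop) :
  (forall i, borel [set x | P i x]) -> borel [set x | forall i, P i x].
Proof.
move=> bP; rewrite (_ : mkset _ = ~` [set x | exists i, ~ P i x]).
  by apply: borelC; apply: borel_ex => i; exact: borel_not.
apply/seteqP; split => x /=; first by move=> Px [i]; apply.
by move=> h i; apply: contrapT => nP; apply: h; exists i.
Qed.

Lemma borel_or (P Q : T -> Prop) :
  borel [set x | P x] -> borel [set x | Q x] -> borel [set x | P x \/ Q x].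
Proof.
move=> bP bQ; rewrite (_ : mkset _ = [set x | exists b : bool, if b then P x else Q x]).
  by apply: borel_ex => -[].
by apply/seteqP; split=> x /=; [move=> [|]; [exists true|exists false]|move=> [[]]; auto].
Qed.

Lemma borel_and (P Q : T -> Prop) :
  borel [set x | P x] -> borel [set x | Q x] -> borel [set x | P x /\ Q x].
Proof.
move=> bP bQ; rewrite (_ : mkset _ = [set x | forall b : bool, if b then P x else Q x]).
  by apply: borel_all => -[].
apply/seteqP; split=> x /=; first by move=> [? ?] [].
by move=> h; split; [exact: (h true)|exact: (h false)].
Qed.

Lemma borel_imp (P Q : T -> Prop) :
  borel [set x | P x] -> borel [set x | Q x] -> borel [set x | P x -> Q x].
Proof.
move=> bP bQ; rewrite (_ : mkset _ = [set x | ~ P x \/ Q x]).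
  by apply: borel_or => //; exact: borel_not.
apply/seteqP; split=> x /=; last by move=> [].
by move=> h; have [/h|] := pselect (P x); [right|left].
Qed.

Lemma borel_ind (Pr : set (set T)) :
  (forall A, open A -> Pr A) -> (forall A, Pr A -> Pr (~` A)) ->
  (forall A : nat -> set T, (forall n, Pr (A n)) -> Pr (\bigcup_n A n)) ->
  forall A, borel A -> Pr A.
Proof.
move=> Po PC PU A; apply; split => //; split => //; first by apply: Po; exact: open0.
by move=> B /PC; rewrite setTD.
Qed.

End borel_calculus.

Lemma borel_mapP (T U : topologicalType) (f : T -> U) :
  (forall A, open A -> borel (f @^-1` A)) -> borel_map f.
Proof.
move=> bf; apply: borel_ind => // A; first exact: borelC.
by move=> bA; rewrite preimage_bigcup; exact: borel_bigcup.
Qed.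

Lemma continuous_borel (T U : topologicalType) (f : T -> U) :
  continuous f -> borel_map f.
Proof. by move=> /continuousP cf; apply: borel_mapP => A /cf; exact: borel_open. Qed.

Lemma borel_map_comp (T U V : topologicalType) (f : T -> U) (g : U -> V) :
  borel_map f -> borel_map g -> borel_map (g \o f).
Proof. by move=> bf bg B /bg/bf. Qed.

Lemma borel_map_baire (T : topologicalType) (f : T -> baire) :
  (forall i j, borel [set t | f t i = j]) -> borel_map f.
Proof.
move=> bf; apply: borel_mapP => A oA.
have bs (s : seq nat) : borel [set t | pre (f t) (size s) = s].
  rewrite (_ : mkset _ = [set t | forall i, i < size s -> f t i = nth 0 s i]).
    by apply: borel_all => i; apply: borel_imp => //; exact: borel_cst.
  apply/seteqP; split=> t /= e; first by apply/preP; rewrite pre_nth.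
  by rewrite -[RHS]pre_nth; exact/preP.
rewrite (_ : _ @^-1` _ = [set t | exists s : seq nat,
    pre (f t) (size s) = s /\ [set y | pre y (size s) = s] `<=` A]).
  by apply: borel_ex => s; apply: borel_and => //; exact: borel_cst.
apply/seteqP; split => t /=; last by move=> [s [e]]; apply.
move: oA; rewrite openE => /[apply] /nbhs_baire[n nA].
by exists (pre (f t) n); rewrite size_pre; split => // y /=; exact: nA.
Qed.

Lemma borel_map_coord (T : topologicalType) (f : T -> baire) i (D : set nat) :
  borel_map f -> borel [set t | D (f t i)].
Proof. move=> /(_ [set y | D (y i)]); apply; apply: borel_open.
by apply: (@open_coord baire id) => y; exact: cvg_id.
Qed.

(** Taking the minimal witness keeps choices Borel in parameters, see [borel_least]. The default is
    0 if there is no witness. *)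
Definition least (P : nat -> Prop) : nat :=
  if pselect (exists j, `[< P j >]) is left h then ex_minn h else 0.

Lemma least_ex (P : nat -> Prop) j : P j -> P (least P).
Proof.
move=> Pj; rewrite /least; case: pselect => [h|[]]; last by exists j; apply/asboolP.
by case: ex_minnP => k /asboolP.
Qed.

Lemma borel_least (T : topologicalType) (P : nat -> T -> Prop) j :
  (forall i, borel [set t | P i t]) -> borel [set t | least (P^~ t) = j].
Proof.
move=> bP; rewrite (_ : mkset _ = [set t | (P j t /\ forall k, k < j -> ~ P k t) \/
    (j = 0 /\ forall k, ~ P k t)]).
  have nP k : borel [set t | ~ P k t] by apply: borel_not; exact: bP.
  apply: borel_or; apply: borel_and.
  - exact: bP.
  - by apply: borel_all => k; apply: borel_imp; [exact: borel_cst|exact: nP].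
  - exact: borel_cst.
  - by apply: borel_all => k; exact: nP.
apply/seteqP; split => t /=; rewrite /least.
  case: pselect => [h <-|h <-].
    case: ex_minnP => k /asboolP Pk mk; left; split => // m ltm /asboolP/mk.
    by rewrite leqNgt ltm.
  by right; split => // k Pk; apply: h; exists k; apply/asboolP.
case: pselect => [h|h] [[Pj mj]|[-> nP]] //.
- case: ex_minnP => k /asboolP Pk mk; apply/eqP; rewrite eqn_leq; apply/andP; split.
    by apply: mk; exact/asboolP.
  by rewrite leqNgt; apply/negP => ltkj; exact: (mj k ltkj Pk).
- by exfalso; case: h => k /asboolP Pk; exact: (nP k Pk).
- by case: h; exists j; apply/asboolP.
Qed.

(** Dependent choice. [P] need not be closed under initial segments, so the branch is described
    through truncations of arbitrarily long members of [P]. *)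
Lemma branch_extend (P : seq nat -> Prop) s0 : P s0 ->
  (forall s, P s -> exists i, P (rcons s i)) ->
  exists u, forall n, exists2 s, P s & n <= size s /\ take n s = pre u n.
Proof.
move=> P0 step.
have step' (s : {s | P s}) : exists i, P (rcons (sval s) i) by case: s => s Ps /=; exact: step.
pose nxt s : {s | P s} := exist P (rcons (sval s) (projT1 (cid (step' s)))) (projT2 (cid (step' s))).
pose S n := sval (iter n nxt (exist P s0 P0)).
have PS n : P (S n) by rewrite /S; case: (iter _ _ _).
have SS n : exists i, S n.+1 = rcons (S n) i.
  by rewrite /S iterS /=; exists (projT1 (cid (step' (iter n nxt (exist P s0 P0))))).
have szS n : size (S n) = size s0 + n.
  by elim: n => [|n IH]; [rewrite /S /= addn0|have [i ->] := SS n; rewrite size_rcons IH addnS].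
have takeS n m k : k <= size (S n) -> n <= m -> take k (S m) = take k (S n).
  move=> lek; elim: m => [|m IH]; first by rewrite leqn0 => /eqP ->.
  rewrite leq_eqVlt => /orP[/eqP -> //|]; rewrite ltnS => lenm.
  have [i ->] := SS m; rewrite -cats1 takel_cat ?IH //.
  by apply: leq_trans lek _; rewrite !szS leq_add2l.
exists (fun k => nth 0 (S k.+1) k) => n; exists (S n) => //; split; first by rewrite szS leq_addl.
have szt : size (take n (S n)) = n by rewrite size_takel // szS leq_addl.
apply: (@eq_from_nth _ 0); rewrite szt ?size_pre // => k ltk.
rewrite nth_mkseq // nth_take //.
have h : take k.+1 (S n) = take k.+1 (S k.+1) by apply: takeS => //; rewrite szS leq_addl.
by move/(congr1 (fun s => nth 0 s k)): h; rewrite !nth_take.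
Qed.

Lemma closed_take (z : set (seq nat)) : (forall s i, z (rcons s i) -> z s) ->
  forall s n, z s -> z (take n s).
Proof.
move=> tz; elim/last_ind => [|s a IH] n zs; first by case: n.
have [le|lt] := leqP n (size s); last by rewrite take_oversize // size_rcons.
by rewrite -cats1 takel_cat //; apply: IH; exact: tz zs.
Qed.

(** * Continuity of combined maps *)

Lemma cont_id (T : topologicalType) : continuous (fun t : T => t).
Proof. by move=> t; exact: cvg_id. Qed.

Lemma cont_cst (T U : topologicalType) (u : U) : continuous (fun _ : T => u).
Proof. by move=> t; exact: cvg_cst. Qed.

Lemma cont_comp (T U V : topologicalType) (g : U -> V) (f : T -> U) :
  continuous g -> continuous f -> continuous (fun t => g (f t)).
Proof. by move=> cg cf t; exact: (continuous_comp (cf t) (cg (f t))). Qed.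

Lemma cont_pair (T U V : topologicalType) (f : T -> U) (g : T -> V) :
  continuous f -> continuous g -> continuous (fun t => (f t, g t)).
Proof. by move=> cf cg t; exact: (cvg_pair (cf t) (cg t)). Qed.

Lemma cont_fst (T U V : topologicalType) (f : T -> U * V) :
  continuous f -> continuous (fun t => (f t).1).
Proof. by move=> cf; apply: (cont_comp _ cf) => x; exact: cvg_fst. Qed.

Lemma cont_snd (T U V : topologicalType) (f : T -> U * V) :
  continuous f -> continuous (fun t => (f t).2).
Proof. by move=> cf; apply: (cont_comp _ cf) => x; exact: cvg_snd. Qed.

Definition reidx (h : nat -> nat) (x : baire) : baire := fun i => x (h i).

Lemma cont_reidx h : continuous (reidx h).
Proof.
apply: continuous_to_baire => i t.
by apply/nbhs_baire; exists (h i).+1 => y /preP e; exact: e.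
Qed.

Ltac cont :=
  lazymatch goal with
  | |- continuous fst => apply: cont_fst; exact: cont_id
  | |- continuous snd => apply: cont_snd; exact: cont_id
  | |- continuous (fun t => t) => exact: cont_id
  | |- continuous (fun _ => ?u) => exact: cont_cst
  | |- continuous (fun t => (@?f t, @?g t)) =>
      apply: (@cont_pair _ _ _ f g); cont
  | |- continuous (fun t => fst (@?f t)) => apply: (@cont_fst _ _ _ f); cont
  | |- continuous (fun t => snd (@?f t)) => apply: (@cont_snd _ _ _ f); cont
  | |- continuous (fun t => reidx ?h (@?f t)) =>
      apply: (@cont_comp _ _ _ (reidx h) f); [exact: cont_reidx|cont]
  | |- continuous (fun t => ?g (@?f t)) =>
      apply: (@cont_comp _ _ _ g f); [by []|cont]
  | |- continuous ?g => by []
  end.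

(** * Polish spaces *)

Section polish_spaces.
Variable R : realType.
Local Open Scope ring_scope.
Implicit Types T U : topologicalType.

Definition radn (n : nat) : R := n.+1%:R^-1.

Lemma radn_gt0 n : 0 < radn n.
Proof. by rewrite invr_gt0 ltr0Sn. Qed.

Lemma radn_lt m n : (radn m < radn n) = (n < m)%N.
Proof. by rewrite ltf_pV2 ?posrE ?ltr0Sn // ltr_nat ltnS. Qed.

Lemma radn_le m n : (radn m <= radn n) = (n <= m)%N.
Proof. by rewrite leNgt radn_lt -leqNgt. Qed.

Lemma radn_small (e : R) : 0 < e -> exists n, radn n < e.
Proof.
move=> e0; exists (Num.bound e^-1).
rewrite invf_plt ?posrE ?ltr0Sn //.
apply: (lt_trans (archi_boundP _)); first by rewrite invr_ge0 ltW.
by rewrite ltr_nat.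
Qed.

Lemma separable_enum T (t0 : T) : separable T ->
  exists y : nat -> T, forall O : set T, O !=set0 -> open O -> exists i, O (y i).
Proof.
move=> [D /pfcard_geP[D0|[f]] dD].
  have := dD setT; rewrite D0 setI0 => h.
  by have [] := h (ex_intro _ t0 I) openT.
exists f => O On oO; have [d [Od Dd]] := dD O On oO.
have /(_ d Dd) [i _ ie] := @surj _ _ _ _ f.
by exists i; rewrite ie.
Qed.

Section baire_metric.

Definition first_diff (x y : baire) : nat :=
  if pselect (exists n, x n != y n) is left h then ex_minn h else 0.

Definition baire_dist (x y : baire) : R := if x == y then 0 else radn (first_diff x y).

Lemma baire_dist_lt x y n : (baire_dist x y < radn n) <-> pre x n.+1 = pre y n.+1.
Proof.
rewrite /baire_dist; case: eqP => [->|/eqP nxy]; first by rewrite radn_gt0.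
rewrite /first_diff; case: pselect => [h|h].
  case: ex_minnP => m dm minm; rewrite radn_lt; split=> [ltnm|/preP e].
    apply/preP => i; rewrite ltnS => lein; apply/eqP; apply: contraT => /minm lemi.
    by have := leq_ltn_trans (leq_trans lemi lein) ltnm; rewrite ltnn.
  by rewrite ltnNge; apply/negP => lemn; move: dm; rewrite e ?eqxx.
exfalso; move/eqP: nxy; apply; apply/funext => i; apply/eqP; apply: contraT => d.
by case: h; exists i.
Qed.

Lemma baire_dist_ge0 x y : 0 <= baire_dist x y.
Proof. by rewrite /baire_dist; case: ifP => // _; exact/ltW/radn_gt0. Qed.

Lemma baire_dist_metric : is_metric baire_dist.
Proof.
split=> [x y|x y|x y|x y z]; first exact: baire_dist_ge0.
- rewrite /baire_dist; case: eqP => [->|ne]; split => //.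
  by move=> e; have := radn_gt0 (first_diff x y); rewrite e ltxx.
- rewrite /baire_dist eq_sym; case: eqP => // ne; congr radn; rewrite /first_diff.
  case: pselect => [h|h]; case: pselect => [h'|h'] //; last first.
  + by case: h; case: h' => n; rewrite eq_sym; exists n.
  + by case: h'; case: h => n; rewrite eq_sym; exists n.
  case: ex_minnP => m dm mm; case: ex_minnP => m' dm' mm'.
  by apply/eqP; rewrite eqn_leq mm 1?eq_sym // mm' 1?eq_sym.
- have [->|/eqP nxz] := eqVneq x z; first by rewrite {1}/baire_dist eqxx addr_ge0 ?baire_dist_ge0.
  (* The distance is an ultrametric: if both summands were below [baire_dist x z], the prefixes of
     [x] and [z] would agree past their first difference. *)
  rewrite leNgt; apply/negP => h.
  have e : baire_dist x z = radn (first_diff x z) by rewrite /baire_dist; case: eqP.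
  have h1 : baire_dist x y < radn (first_diff x z).
    by rewrite -e; apply: le_lt_trans h; rewrite lerDl baire_dist_ge0.
  have h2 : baire_dist y z < radn (first_diff x z).
    by rewrite -e; apply: le_lt_trans h; rewrite lerDr baire_dist_ge0.
  move/baire_dist_lt: h1 => h1; move/baire_dist_lt: h2 => h2.
  by have /baire_dist_lt := etrans h1 h2; rewrite e ltxx.
Qed.

Lemma polish_baire : polish R baire.
Proof.
split.
  exists (range (fun s : seq nat => nth 0%N s : baire)); first by apply: (sub_countable (card_image_le _ _)); exact: countableP.
  move=> O [x Ox]; rewrite openE => /(_ x Ox) /nbhs_baire[n nO].
  exists (nth 0%N (pre x n)); split; last by exists (pre x n).
  by apply: nO; have := pre_nth (pre x n); rewrite size_pre.
exists baire_dist; split; first exact: baire_dist_metric.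
- move=> x A; split.
    move=> /nbhs_baire[n nA]; exists (radn n); first exact: radn_gt0.
    by move=> y /= /baire_dist_lt e; apply: nA; apply: pre_le (esym e).
  move=> [e /radn_small[n ne] eA]; apply/nbhs_baire; exists n.+1 => y ey.
  by apply: eA => /=; apply: lt_trans ne; exact/baire_dist_lt.
- move=> u cu; pose N n := projT1 (cid (cu _ (radn_gt0 n))).
  have NP n m k : (N n <= m)%N -> (N n <= k)%N -> pre (u m) n.+1 = pre (u k) n.+1.
    by rewrite /N; case: cid => /= K h lem lek; apply/baire_dist_lt; exact: h.
  exists (fun i => u (N i) i : nat) => A /nbhs_baire[n nA].
  pose M := \max_(i < n) N i.
  exists M => // m /= leMm; apply: nA; apply/preP => i ltin.
  have leN : (N i <= m)%N by apply: leq_trans leMm; exact: (leq_bigmax (Ordinal ltin)).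
  by have /preP -> := NP i m (N i) leN (leqnn _).
Qed.

End baire_metric.

Lemma polish_prod T U : polish R T -> polish R U -> polish R (T * U)%type.
Proof.
move=> [[D cD dD] [d [dm dt dc]]] [[D' cD' dD'] [d' [dm' dt' dc']]]; split.
  exists (D `*` D'); first exact: countableX.
  move=> O [[a b] Oab]; rewrite openE => /(_ _ Oab) [[P Q] /= [nP nQ] PQ].
  have [x [Px Dx]] := dD _ (ex_intro _ a nP) (open_interior P).
  have [y [Qy Dy]] := dD' _ (ex_intro _ b nQ) (open_interior Q).
  by exists (x, y); split => //; apply: PQ; split; exact: interior_subset.
exists (fun p q => Num.max (d p.1 q.1) (d' p.2 q.2)); split.
- split=> [x y|[x x'] [y y']|x y|x y z] /=.
  + by rewrite le_max metric_ge0.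
  + split=> [h|[-> ->]]; last by rewrite (metric_eq0 dm _ _).2 // (metric_eq0 dm' _ _).2 // maxxx.
    have := lexx (0 : R); rewrite -{1}h ge_max => /andP[h1 h2].
    by congr (_, _); [apply/(metric_eq0 dm)|apply/(metric_eq0 dm')]; apply/eqP;
      rewrite eq_le ?h1 ?h2 metric_ge0.
  + by rewrite (Defs.metric_sym dm) (Defs.metric_sym dm').
  + rewrite ge_max; apply/andP; split.
      apply: le_trans (Defs.metric_triangle dm _ y.1 _) _.
      by apply: lerD; rewrite le_max lexx.
    apply: le_trans (Defs.metric_triangle dm' _ y.2 _) _.
    by apply: lerD; rewrite le_max lexx orbT.
- move=> [x x'] A; split.
    move=> [[P Q] /= [/dt[e e0 eP] /dt'[e' e0' eQ]] PQ].
    exists (Num.min e e'); first by rewrite lt_min e0.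
    move=> [y y'] /=; rewrite gt_max !lt_min => /andP[/andP[h1 _] /andP[_ h2]].
    by apply: PQ; split; [apply: eP|apply: eQ].
  move=> [e e0 eA]; exists ([set y | d x y < e], [set y | d' x' y < e]) => /=.
    by split; [apply/dt|apply/dt']; exists e.
  by move=> [y y'] /= [h1 h2]; apply: eA; rewrite /= gt_max h1.
- move=> u cu.
  have [|l ul] := dc (fst \o u).
    move=> e /cu[N h]; exists N => m n lm ln; move: (h m n lm ln).
    by rewrite gt_max => /andP[].
  have [|l' ul'] := dc' (snd \o u).
    move=> e /cu[N h]; exists N => m n lm ln; move: (h m n lm ln).
    by rewrite gt_max => /andP[].
  exists (l, l').
  have -> : u = (fun n => ((fst \o u) n, (snd \o u) n)) by apply/funext => n /=; case: (u n).
  exact: cvg_pair ul ul'.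
Qed.

End polish_spaces.

Section polish_parametrization.
Variable R : realType.
Implicit Types T U Y : topologicalType.
Local Notation radn := (@radn R).

Lemma polish_base T : polish R T -> exists U : nat -> set T,
  (forall n, open (U n)) /\
  forall x A, nbhs x A -> exists n, U n x /\ U n `<=` A.
Proof.
move=> [sT [d [dm dt _]]].
have [[t0 _]|T0] := pselect (exists t : T, True); last first.
  by exists (fun _ => set0); split=> [_|x]; [exact: open0|case: T0; exists x].
have [y dy] := separable_enum t0 sT.
have ob x r : open [set z | (d x z < r)%R].
  rewrite openE => z /= dxz; apply/dt; exists (r - d x z)%R; first by rewrite subr_gt0.
  move=> z' /=; rewrite ltrBrDl; exact: le_lt_trans (Defs.metric_triangle dm _ _ _).
exists (fun n => if @unpickle (nat * nat)%type n is Some (i, k)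
  then [set z | (d (y i) z < radn k)%R] else set0); split.
  by move=> n; case: unpickle => [[i k]|]; [exact: ob|exact: open0].
move=> x A /dt[e e0 eA].
have [k ke] := @radn_small R (e / 2)%R ltac:(lra).
have [i /= di] : exists i, (d x (y i) < radn k)%R.
  apply: (dy [set z | (d x z < radn k)%R]) => //; exists x.
  by rewrite /= (metric_eq0 dm _ _).2 // radn_gt0.
exists (pickle (i, k)); rewrite pickleK /=; split; first by rewrite (Defs.metric_sym dm).
move=> z /= diz; apply: eA => /=.
by apply: le_lt_trans (Defs.metric_triangle dm _ (y i) _) _; lra.
Qed.

Lemma polish_hausdorff T : polish R T -> hausdorff_space T.
Proof.
move=> [_ [d [dm dt _]]] x y cl; apply/(metric_eq0 dm); apply/eqP.
rewrite eq_le (metric_ge0 dm) andbT leNgt; apply/negP => d0.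
have h : (0 < d x y / 2)%R by lra.
have [||z [/= dxz dyz]] := cl [set z | (d x z < d x y / 2)%R] [set z | (d y z < d x y / 2)%R].
- by apply/dt; exists (d x y / 2)%R.
- by apply/dt; exists (d x y / 2)%R.
have := Defs.metric_triangle dm x z y; rewrite (Defs.metric_sym dm z y); lra.
Qed.

Lemma closed_eq_fun T U (f g : T -> U) : hausdorff_space U ->
  continuous f -> continuous g -> closed [set t | f t = g t].
Proof.
move=> hU cf cg; rewrite closedE => t /= nt; apply: contrapT => nfg.
apply: nt.
move: hU; rewrite open_hausdorff => /(_ (f t) (g t)).
case; first exact/eqP.
move=> [A B] /= [/set_mem Af /set_mem Bg] [oA oB AB].
have hA : nbhs t (f @^-1` A) by apply: (cf t); exact: open_nbhs_nbhs.
have hB : nbhs t (g @^-1` B) by apply: (cg t); exact: open_nbhs_nbhs.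
apply: filterS (filterI hA hB) => u /= [Au Bu] e.
have : (A `&` B) (f u) by split => //; rewrite e.
by rewrite (eqP AB).
Qed.

(** A point off [C] has a first length at which no member of [C] shares its prefix; it is sent to a
    member of [C] chosen from the prefix one shorter. So [r] is locally constant off [C], and near a
    point of [C] it preserves long prefixes. *)
Lemma closed_retract (C : set baire) : closed C -> C !=set0 ->
  exists r : baire -> baire, [/\ continuous r, forall x, C (r x) & forall x, C x -> r x = x].
Proof.
move=> cC [c0 Cc0].
pose ok (s : seq nat) c := C c /\ pre c (size s) = s.
pose ch s := if pselect (exists c, ok s c) is left h then projT1 (cid h) else c0.
have chC s : C (ch s) by rewrite /ch; case: pselect => // h; case: cid => c [].
have chP s : (exists c, ok s c) -> pre (ch s) (size s) = s.
  by rewrite /ch; case: pselect => // h; case: cid => c [].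
have exn x : ~ C x -> exists n, `[< ~ exists c, ok (pre x n) c >].
  move=> nCx; apply: contrapT => h; apply: nCx; move: cC; rewrite closedE; apply.
  move=> /nbhs_baire[n hn]; apply: h; exists n; apply/asboolP => -[c [Cc]].
  by rewrite size_pre => /hn.
pose r x := if pselect (C x) is right h then ch (pre x (ex_minn (exn x h)).-1) else x.
have rC x : C x -> r x = x by rewrite /r; case: pselect.
have rN x m : (exists c, ok (pre x m) c) -> pre (r x) m = pre x m.
  move=> okm; rewrite /r; case: pselect => // nC.
  case: ex_minnP => n /asboolP nok minn.
  have ltmn : m < n.
    rewrite ltnNge; apply/negP => lenm; apply: nok; case: okm => c [Cc].
    rewrite size_pre => e; exists c; split => //.
    by rewrite size_pre; exact: pre_le e.
  have ok1 : exists c, ok (pre x n.-1) c.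
    apply: contrapT => /asboolP/minn; rewrite leqNgt => /negP; apply.
    by case: n ltmn {nok minn}.
  have := chP _ ok1; rewrite size_pre => e; apply: pre_le e.
  by case: n ltmn {nok minn ok1}.
exists r; split => //; last first.
  by move=> x; rewrite /r; case: pselect.
move=> x A /nbhs_baire[m mA]; apply/nbhs_baire.
have [Cx|nCx] := pselect (C x).
  exists m => y e; apply: mA; rewrite (rC x) // -e; apply: rN.
  by exists x; split => //; rewrite size_pre.
move: mA; rewrite {1}/r; case: pselect => // nCx' mA.
case: (ex_minnP (exn x nCx')) mA => n /asboolP nok minn mA; exists n => y e; apply: mA.
rewrite /r; case: pselect => [Cy|nCy].
  by case: nok; exists y; split => //; rewrite size_pre.
case: ex_minnP => n' /asboolP nok' minn'; congr (pre (ch _) m).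
have -> : n' = n.
  apply/eqP; rewrite eqn_leq; apply/andP; split.
    by apply: minn'; apply/asboolP; rewrite e.
  have len' : n' <= n by apply: minn'; apply/asboolP; rewrite e.
  by apply: minn; apply/asboolP; rewrite -(pre_le len' e).
by apply: pre_le e; exact: leq_pred.
Qed.

(** [C] is the closed set of index sequences into a dense sequence that are Cauchy at a fixed rate.
    [q] takes limits after retracting onto [C]; [e] picks at each stage the least index within
    [radn n], which is a Borel choice. *)
Lemma polish_parametrization Y (y0 : Y) : polish R Y ->
  exists (q : baire -> Y) (e : Y -> baire),
    [/\ continuous q, borel_map e & cancel e q].
Proof.
move=> [sY [d [dm dt dc]]]; have [y dy] := separable_enum y0 sY.
pose C : set baire := [set a | forall n m, (d (y (a n)) (y (a m)) <= radn n + radn m)%R].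
have cC : closed C.
  rewrite (_ : C = \bigcap_n \bigcap_m
      [set a : baire | (d (y (a n)) (y (a m)) <= radn n + radn m)%R]); last first.
    by apply/seteqP; split=> [a Ca n _ m _|a Ca n m]; [exact: Ca|exact: Ca].
  apply: closed_bigI => n _; apply: closed_bigI => m _.
  rewrite closedE => a /= na; apply: contrapT => nle; apply: na.
  apply/nbhs_baire; exists (maxn n m).+1 => b /preP eb.
  by rewrite !eb // ltnS (leq_maxl, leq_maxr).
have ob x r : open [set z | (d x z < r)%R].
  rewrite openE => z /= dxz; apply/dt; exists (r - d x z)%R; first by rewrite subr_gt0.
  move=> z' /=; rewrite ltrBrDl; exact: le_lt_trans (Defs.metric_triangle dm _ _ _).
have exi z n : exists i, (d z (y i) < radn n)%R.
  by apply: (dy [set x | (d z x < radn n)%R]) => //; exists z; rewrite /= (metric_eq0 dm _ _).2 // radn_gt0.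
pose e (z : Y) : baire := fun n => ex_minn (exi z n).
have eP z n : (d z (y (e z n)) < radn n)%R by rewrite /e; case: ex_minnP.
have Ce z : C (e z).
  move=> n m; apply: le_trans (Defs.metric_triangle dm _ z _) _.
  by rewrite (Defs.metric_sym dm _ z); apply: lerD; exact/ltW.
have [r [cr rC rid]] := closed_retract cC (ex_intro _ _ (Ce y0)).
have lim a : C a -> exists l, forall n, (d (y (a n)) l <= radn n)%R.
  move=> Ca; have [|l ul] := dc (fun n => y (a n)).
    move=> eps eps0; have [k ke] := @radn_small R (eps / 2)%R ltac:(lra).
    exists k => m n lem len; apply: le_lt_trans (Ca m n) _.
    have h1 : (radn m <= radn k)%R by rewrite radn_le.
    have h2 : (radn n <= radn k)%R by rewrite radn_le.
    lra.
  exists l => n; rewrite leNgt; apply/negP => ltn.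
  have [k ke] := @radn_small R ((d (y (a n)) l - radn n) / 2)%R ltac:(lra).
  have [|N _ hN] := ul [set z | (d l z < radn k)%R].
    by apply/dt; exists (radn k) => //; exact: radn_gt0.
  have /= h1 := hN (maxn N k) (leq_maxl _ _).
  have := Ca n (maxn N k); have := Defs.metric_triangle dm (y (a n)) (y (a (maxn N k))) l.
  rewrite (Defs.metric_sym dm (y (a (maxn N k))) l).
  have h2 : (radn (maxn N k) <= radn k)%R by rewrite radn_le leq_maxr.
  lra.
pose q a := projT1 (cid (lim _ (rC a))).
have qP a n : (d (y (r a n)) (q a) <= radn n)%R by rewrite /q; case: cid.
exists q, e; split.
- move=> a A /dt[eps eps0 epsA].
  have [k ke] := @radn_small R (eps / 2)%R ltac:(lra).
  have := continuous_coord k (cr a); apply: filterS => b /= eb; apply: epsA => /=.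
  apply: le_lt_trans (Defs.metric_triangle dm _ (y (r a k)) _) _.
  have := qP a k; have := qP b k; rewrite eb (Defs.metric_sym dm (q a)); lra.
- apply: borel_map_baire => n i.
  rewrite (_ : mkset _ = [set z | (d z (y i) < radn n)%R /\
      forall j, (j < i)%N -> ~ (d z (y j) < radn n)%R]).
    have bo j : borel [set z | (d z (y j) < radn n)%R].
      apply: borel_open; rewrite (_ : mkset _ = [set z | (d (y j) z < radn n)%R]) //.
      by apply/seteqP; split => z /=; rewrite (Defs.metric_sym dm).
    apply: borel_and => //; apply: borel_all => j; apply: borel_imp; first exact: borel_cst.
    exact: borel_not.
  apply/seteqP; split => z; rewrite /e /=; case: ex_minnP => k dk mink.
    by move=> <-; split => // j ltjk /mink; rewrite leqNgt ltjk.
  move=> [di mini]; apply/eqP; rewrite eqn_leq mink //= leqNgt; apply/negP => /mini.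
  exact.
- move=> z; apply/(metric_eq0 dm); apply/eqP; rewrite eq_le (metric_ge0 dm) andbT leNgt.
  apply/negP => d0; have [k ke] := @radn_small R (d (q (e z)) z / 2)%R ltac:(lra).
  have := qP (e z) k; rewrite rid //; have := eP z k.
  have := Defs.metric_triangle dm (q (e z)) (y (e z k)) z.
  rewrite (Defs.metric_sym dm (q (e z)) (y _)) (Defs.metric_sym dm z (y _)); lra.
Qed.

Lemma borel_map_pair T U (V : topologicalType) (f : T -> U) (g : T -> V) : polish R U -> polish R V ->
  borel_map f -> borel_map g -> borel_map (fun t => (f t, g t)).
Proof.
move=> /polish_base[B [oB bB]] /polish_base[B' [oB' bB']] bf bg; apply: borel_mapP => A.
rewrite openE => oA.
rewrite (_ : _ @^-1` _ = [set t | exists n m, B n (f t) /\ B' m (g t) /\ (B n `*` B' m `<=` A)]).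
  apply: borel_ex => n; apply: borel_ex => m; apply: borel_and; last apply: borel_and.
  - by apply: (bf (B n)); exact: borel_open.
  - by apply: (bg (B' m)); exact: borel_open.
  - exact: borel_cst.
apply/seteqP; split=> t /=; last by move=> [n [m [h1 [h2]]]]; apply; split.
move=> /oA [[P Q] /= [/bB[n [h1 h2]] /bB'[m [h3 h4]]] PQ].
by exists n, m; do 2![split => //] => -[u v] [/= /h2 ? /h4 ?]; exact: PQ.
Qed.

Lemma prod_salgebraE T : polish R T ->
  prod_salgebra (@borel T) = @borel (T * T)%type.
Proof.
move=> pT; apply/seteqP; split => A.
  apply; split; first exact: smallest_sigma_algebra.
  move=> _ [B bB [C bC <-]]; apply: borel_and.
  - exact: (continuous_borel (cont_fst (@cont_id _)) bB).
  - exact: (continuous_borel (cont_snd (@cont_id _)) bC).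
move=> bA; apply: bA; split; first exact: smallest_sigma_algebra.
have [B [oB bB]] := polish_base pT.
move=> O; rewrite openE => oO.
rewrite (_ : O = \bigcup_k (if @unpickle (nat * nat)%type k is Some (n, m)
    then (if `[< B n `*` B m `<=` O >] then B n `*` B m else set0) else set0)).
  apply: sigma_algebra_bigcup => k; case: unpickle => [[n m]|]; last exact: sigma_algebra0.
  case: ifP => _; last exact: sigma_algebra0.
  apply: sub_sigma_algebra; exists (B n); first exact: borel_open.
  by exists (B m) => //; exact: borel_open.
apply/seteqP; split => [[x y] Oxy|x [k _]].
  have [[P Q] /= [/bB[n [h1 h2]] /bB[m [h3 h4]]] PQ] := oO _ Oxy.
  exists (pickle (n, m)) => //; rewrite pickleK; case: asboolP => // -[].
  by move=> [u v] [/= /h2 ? /h4 ?]; exact: PQ.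
by case: unpickle => // -[n m]; case: asboolP => // + h; apply.
Qed.

End polish_parametrization.

(** * Analytic sets as projections of closed sets *)

(** The working form of analyticity, in which witnesses are always reals; on Polish spaces it agrees
    with [analytic] by [analytic_susl] and [susl_analytic]. *)
Definition susl (T : topologicalType) (A : set T) :=
  exists2 Q : set (T * baire)%type, closed Q & A = [set t | exists u, Q (t, u)].

Definition cosusl (T : topologicalType) (A : set T) := susl (~` A).

(** A real is split into columns, so that countably many real witnesses can be merged into one. *)
Definition bcol (n : nat) : baire -> baire := reidx (fun k => pickle (n, k)).

Definition bglue (b : nat -> baire) : baire :=
  fun i => if @unpickle (nat * nat)%type i is Some (n, k) then b n k else 0.

Lemma bcol_bglue b n : bcol n (bglue b) = b n.
Proof. by apply/funext => k; rewrite /bcol /reidx /bglue pickleK. Qed.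

Lemma preimage_closed_cont (T U : topologicalType) (f : T -> U) (Q : set U) :
  continuous f -> closed Q -> closed [set t | Q (f t)].
Proof. by move=> /continuous_closedP cf /cf. Qed.

Section susl_calculus.
Variable T : topologicalType.

Lemma susl_closed (A : set T) : closed A -> susl A.
Proof.
move=> cA; exists [set p | A p.1]; first by apply: preimage_closed_cont => //; cont.
by apply/seteqP; split=> t /=; [exists (fun _ => 0)|move=> []].
Qed.

Lemma susl_cst (P : Prop) : susl [set _ : T | P].
Proof.
apply: susl_closed; have [p|np] := pselect P.
  by rewrite (_ : mkset _ = setT); [exact: closedT|apply/seteqP; split].
by rewrite (_ : mkset _ = set0); [exact: closed0|apply/seteqP; split].
Qed.

Lemma susl_ex_nat (P : nat -> T -> Prop) :
  (forall n, susl [set t | P n t]) -> susl [set t | exists n, P n t].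
Proof.
move=> /(_ _)/cid2 h; pose Q n := projT1 (h n).
have cQ n : closed (Q n) by rewrite /Q; case: (h n).
have PQ n t : P n t <-> exists u, Q n (t, u).
  by rewrite /Q; case: (h n) => /= Qn _ e; rewrite -[P n t]/([set t | P n t] t) e.
(* The first entry of the witness names the index. It splits Baire space into clopen pieces, so the
   pieces of all indices together still form a closed set. *)
exists (\bigcap_n [set p : T * baire | p.2 0 <> n \/ Q n (p.1, reidx S p.2)]).
  apply: closed_bigI => n _.
  rewrite (_ : mkset _ = [set p : T * baire | p.2 0 <> n] `|`
      [set p : T * baire | Q n (p.1, reidx S p.2)]) //.
  apply: closedU; last by apply: preimage_closed_cont => //; cont.
  rewrite -openC (_ : ~` _ = [set p : T * baire | p.2 0 = n]).
    by apply: (@open_coord _ snd 0 [set n]); cont.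
  by apply/seteqP; split => p /=; [exact: contrapT|move=> e []].
apply/seteqP; split => t /=.
  move=> [n /PQ[u Qu]]; exists (fun i => if i is k.+1 then u k else n) => m _ /=.
  by have [<-|ne] := pselect (n = m); [right|left].
by move=> [u hu]; exists (u 0); apply/PQ; have [//|] := hu (u 0) I; exists (reidx S u).
Qed.

Lemma susl_all_nat (P : nat -> T -> Prop) :
  (forall n, susl [set t | P n t]) -> susl [set t | forall n, P n t].
Proof.
move=> /(_ _)/cid2 h; pose Q n := projT1 (h n).
have cQ n : closed (Q n) by rewrite /Q; case: (h n).
have PQ n t : P n t <-> exists u, Q n (t, u).
  by rewrite /Q; case: (h n) => /= Qn _ e; rewrite -[P n t]/([set t | P n t] t) e.
exists (\bigcap_n [set p : T * baire | Q n (p.1, bcol n p.2)]).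
  by apply: closed_bigI => n _; apply: preimage_closed_cont => //; rewrite /bcol; cont.
apply/seteqP; split => t /=.
  move=> hP; have /(_ _)/cid hu n := (PQ n t).1 (hP n).
  by exists (bglue (fun n => projT1 (hu n))) => n _ /=; rewrite bcol_bglue; case: (hu n).
by move=> [u hu] n; apply/PQ; exists (bcol n u); exact: (hu n I).
Qed.

Lemma susl_ex (I : countType) (P : I -> T -> Prop) :
  (forall i, susl [set t | P i t]) -> susl [set t | exists i, P i t].
Proof.
move=> bP; rewrite (_ : mkset _ =
  [set t | exists n, if @unpickle I n is Some i then P i t else False]).
  by apply: susl_ex_nat => n; case: unpickle => [i|]; [exact: bP|exact: susl_cst].
apply/seteqP; split => [x [i Pix]|x [n /=]]; last by case: unpickle => // i; exists i.
by exists (pickle i) => //=; rewrite pickleK.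
Qed.

Lemma susl_all (I : countType) (P : I -> T -> Prop) :
  (forall i, susl [set t | P i t]) -> susl [set t | forall i, P i t].
Proof.
move=> bP; rewrite (_ : mkset _ =
  [set t | forall n, if @unpickle I n is Some i then P i t else True]).
  by apply: susl_all_nat => n; case: unpickle => [i|]; [exact: bP|exact: susl_cst].
apply/seteqP; split => [x Px n|x /= Px i]; first by case: unpickle.
by have := Px (pickle i); rewrite pickleK.
Qed.

Lemma susl_and (P Q : T -> Prop) :
  susl [set x | P x] -> susl [set x | Q x] -> susl [set x | P x /\ Q x].
Proof.
move=> bP bQ; rewrite (_ : mkset _ = [set x | forall b : bool, if b then P x else Q x]).
  by apply: susl_all => -[].
apply/seteqP; split=> x /=; first by move=> [? ?] [].
by move=> h; split; [exact: (h true)|exact: (h false)].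
Qed.

Lemma susl_or (P Q : T -> Prop) :
  susl [set x | P x] -> susl [set x | Q x] -> susl [set x | P x \/ Q x].
Proof.
move=> bP bQ; rewrite (_ : mkset _ = [set x | exists b : bool, if b then P x else Q x]).
  by apply: susl_ex => -[].
by apply/seteqP; split=> x /=; [move=> [|]; [exists true|exists false]|move=> [[]]; auto].
Qed.

Lemma susl_preim (U : topologicalType) (f : T -> U) (A : set U) :
  continuous f -> susl A -> susl [set t | A (f t)].
Proof.
move=> cf [Q cQ ->]; exists [set p | Q (f p.1, p.2)] => //.
by apply: preimage_closed_cont => //; cont.
Qed.

Lemma susl_ex_baire (P : T -> baire -> Prop) :
  susl [set p : T * baire | P p.1 p.2] -> susl [set t | exists b, P t b].
Proof.
move=> [Q cQ e]; exists [set p | Q ((p.1, bcol 0 p.2), bcol 1 p.2)].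
  by apply: preimage_closed_cont => //; rewrite /bcol; cont.
have PQ t b : P t b <-> exists u, Q ((t, b), u).
  by rewrite -[P t b]/([set p : T * baire | P p.1 p.2] (t, b)) e.
apply/seteqP; split => t /=; last by move=> [u Qu]; exists (bcol 0 u); apply/PQ; exists (bcol 1 u).
move=> [b /PQ[u Qu]]; exists (bglue (fun n => if n is 0 then b else u)).
by rewrite !bcol_bglue.
Qed.

End susl_calculus.

Section polish_susl.
Variable R : realType.
Implicit Types T Y : topologicalType.

Lemma polish_cases Y : polish R Y -> (Y -> False) \/
  exists (q : baire -> Y) (e : Y -> baire), [/\ continuous q, borel_map e & cancel e q].
Proof.
move=> pY; have [[y0 _]|nY] := pselect (exists y : Y, True); [right|left].
  exact: polish_parametrization pY.
by move=> y; apply: nY; exists y.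
Qed.

Lemma susl_ex_polish T Y (P : T -> Y -> Prop) : polish R Y ->
  susl [set p : T * Y | P p.1 p.2] -> susl [set t | exists y, P t y].
Proof.
move=> /polish_cases[nY|[q [e [cq _ qe]]]] sP.
  rewrite (_ : mkset _ = [set _ | False]); first exact: susl_cst.
  by apply/seteqP; split => t // [y]; case: (nY y).
rewrite (_ : mkset _ = [set t | exists b, P t (q b)]).
  apply: susl_ex_baire.
  apply: (@susl_preim _ _ (fun p : T * baire => (p.1, q p.2)) _ _ sP); cont.
by apply/seteqP; split => t /= [y Py]; [exists (e y); rewrite qe|exists (q y)].
Qed.

Lemma susl_open T (A : set T) : polish R T -> open A -> susl A.
Proof.
move=> pT; have [nT|[q [e [cq _ qe]]]] := polish_cases pT.
  by move=> _; apply: susl_closed; rewrite (_ : A = set0) ?closed0 //;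
    apply/seteqP; split=> t; case: (nT t).
move=> oA; rewrite (_ : A = [set t | exists s : seq nat,
   [set b | pre b (size s) = s] `<=` q @^-1` A /\
   exists b, pre b (size s) = s /\ q b = t]).
  apply: susl_ex => s; apply: susl_and; first exact: susl_cst.
  apply: susl_ex_baire; apply: susl_and; apply: susl_closed.
    rewrite -openC; apply: (@open_pre _ snd (size s) [set s' | s' <> s]); cont.
  by apply: closed_eq_fun (polish_hausdorff pT) _ _; cont.
apply/seteqP; split => t /=; last by move=> [s [h [b [/h + <-]]]].
move=> At; have /(continuous_from_baire (cq _))[n nA] : nbhs (q (e t)) A.
  by apply: open_nbhs_nbhs; rewrite qe.
exists (pre (e t) n); rewrite size_pre; split; first by move=> b; exact: nA.
by exists (e t).
Qed.

Lemma borel_susl T (A : set T) : polish R T -> borel A -> susl A.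
Proof.
move=> pT bA; suff [] : susl A /\ cosusl A by [].
move: A bA; apply: borel_ind => [A oA|A [sA cA]|A sA].
- split; first exact: susl_open.
  by apply: susl_closed; rewrite closedC.
- by split => //; rewrite /cosusl setCK.
- split.
    rewrite (_ : \bigcup_n _ = [set t | exists n, A n t]).
      by apply: susl_ex => n; have [] := sA n.
    by apply/seteqP; split=> t [n]; exists n.
  rewrite /cosusl (_ : ~` _ = [set t | forall n, (~` A n) t]).
    by apply: susl_all => n; have [] := sA n.
  by apply/seteqP; split => t /= h => [n An|[n _]]; [apply: h; exists n|exact: h].
Qed.

Lemma susl_range T (A : set T) : polish R T -> susl A -> A !=set0 ->
  exists2 f : baire -> T, continuous f & range f = A.
Proof.
move=> pT [Q cQ e] [t0 At0].
have [nT|[q [h [cq _ qh]]]] := polish_cases pT; first by case: (nT t0).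
have [||r [cr rC rid]] := @closed_retract [set b | Q (q (bcol 0 b), bcol 1 b)].
- by apply: preimage_closed_cont => //; rewrite /bcol; cont.
- move: At0; rewrite e => -[u Qu].
  by exists (bglue (fun n => if n is 0 then h t0 else u)); rewrite /= !bcol_bglue qh.
exists (fun b => q (bcol 0 (r b))); first by rewrite /bcol; cont.
rewrite e; apply/seteqP; split => [_ [b _ <-]|t [u Qu]].
  by exists (bcol 1 (r b)); exact: (rC b).
exists (bglue (fun n => if n is 0 then h t else u)) => //.
by rewrite rid /= !bcol_bglue qh.
Qed.

Lemma analytic_susl T (A : set T) : polish R T -> analytic R A -> susl A.
Proof.
move=> pT [Y [f [pY cf <-]]].
rewrite (_ : range f = [set t | exists y, f y = t]).
  apply: (susl_ex_polish pY); apply: susl_closed.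
  by apply: closed_eq_fun (polish_hausdorff pT) _ _; cont.
by apply/seteqP; split => t [y]; exists y.
Qed.

(** The empty set is the range of a map only if the source is empty, so the empty type has to be
    given a topology. *)
Definition empty_space : topologicalType :=
  initial_topology (fun v : void => match v return nat with end).

Lemma susl_analytic T (A : set T) : polish R T -> susl A -> analytic R A.
Proof.
move=> pT sA; have [->|/set0P A0] := eqVneq A set0; last first.
  have [f cf <-] := susl_range pT sA A0.
  by exists baire, f; split => //; exact: polish_baire.
exists empty_space, (fun v : void => match v return T with end); split.
- split; first by exists set0 => [|O [[]]]; exact: countable0.
  exists (fun v : void => match v with end); split; first by split=> -[].
    by case.
  by move=> u; case: (u 0).
- by case.
- by apply/seteqP; split => t // [[]].
Qed.

End polish_susl.

(** * Separation *)

Section separation.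
Variables (R : realType) (T : topologicalType) (pT : polish R T).

Section novikov_trees.
Variable f : nat -> baire -> T.
Hypothesis cf : forall n, continuous (f n).

Definition separated (s : nat -> seq nat) := exists B : nat -> set T,
  [/\ forall n, borel (B n),
      forall n y, pre y (size (s n)) = s n -> B n (f n y)
    & forall t, ~ forall n, B n t].

Definition upd (s : nat -> seq nat) m (x : seq nat) n := if n == m then x else s n.

(** The cylinder of [s m] is the union of those of its one-step extensions. If every extension is
    separated, then taking unions over [j] at index [m] and intersections over [j] at the other
    indices separates [s]. *)
Lemma separated_step s m : ~ separated s ->
  exists j, ~ separated (upd s m (rcons (s m) j)).
Proof.
move=> ns; apply: contrapT => h; apply: ns.
have /(_ _)/cid hB : forall j, separated (upd s m (rcons (s m) j)).
  by move=> j; apply: contrapT => nj; apply: h; exists j.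
pose B j := projT1 (hB j).
have bB j n : borel (B j n) by rewrite /B; case: (hB j) => B0 /= [].
have fB j n y : pre y (size (upd s m (rcons (s m) j) n)) = upd s m (rcons (s m) j) n ->
    B j n (f n y).
  by rewrite /B; case: (hB j) => B0 /= [_ h' _]; exact: h'.
have nB j t : ~ forall n, B j n t by rewrite /B; case: (hB j) => B0 /= [_ _]; exact.
exists (fun n => [set t | if n == m then exists j, B j n t else forall j, B j n t]); split.
- by move=> n; case: (n == m); [apply: borel_ex|apply: borel_all] => j; exact: bB.
- move=> n y; case: eqP => [->|/eqP nm] e; last by move=> j; apply: fB; rewrite /upd (negPf nm).
  exists (y (size (s m))); apply: fB; rewrite /upd eqxx size_rcons preS.
  by rewrite e.
- move=> t h'; have := h' m; rewrite eqxx => -[j Bj]; apply: (nB j t) => n.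
  by have := h' n; case: eqP => [->|_] // /(_ j).
Qed.

Lemma separated_steps s k : ~ separated s -> exists2 s', ~ separated s' &
  forall n, if n < k then exists j, s' n = rcons (s n) j else s' n = s n.
Proof.
move=> ns; elim: k => [|k [s' ns' h]]; first by exists s.
have [j nj] := separated_step k ns'.
exists (upd s' k (rcons (s' k) j)) => // n; have := h n; rewrite /upd.
case: (ltngtP n k) => [ltnk|ltkn|->].
- by rewrite ltnS ltnW.
- by rewrite ltnS leqNgt ltkn.
- by rewrite ltnS leqnn => ->; exists j.
Qed.

(** Otherwise non-separation is propagated, stage [i] extending the sequences with index at most
    [i]. In the limit every index [n] has a real [y n]; two of the points [f n (y n)] differ, and
    disjoint neighbourhoods of them separate a finite stage. *)
Lemma separated_root : (forall t, ~ forall n, range (f n) t) -> separated (fun _ => [::]).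
Proof.
move=> dis; apply: contrapT => ns.
pose S0 := {s : nat -> seq nat | ~ separated s}.
pose nxt i (s : S0) : S0 := let h := cid2 (separated_steps i (proj2_sig s)) in
  exist _ (s2val h) (s2valP h).
pose S i : nat -> seq nat := sval (iteri i (fun i => nxt i.+1) (exist (fun s => ~ separated s) _ ns : S0)).
have nS i : ~ separated (S i) by rewrite /S; case: (iteri _ _ _).
have SS i n : if n <= i then exists j, S i.+1 n = rcons (S i n) j else S i.+1 n = S i n.
  by rewrite /S /= /nxt /=; case: cid2 => /= s' _ /(_ n); rewrite ltnS.
have szS i n : size (S i n) = i - n.
  elim: i => [|i IH]; first by rewrite /S.
  have := SS i n; case: leqP => [leni [j ->]|ltin ->].
    by rewrite size_rcons IH subSn.
  by rewrite IH; apply/eqP; move: ltin => /[dup] /ltnW; rewrite -!subn_eq0 => /eqP -> /eqP ->.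
pose y n : baire := fun k => nth 0 (S (n + k.+1) n) k.
have yS n i : pre (y n) (i - n) = S i n.
  have mono i' j k : k < i' - n -> i' <= j -> nth 0 (S j n) k = nth 0 (S i' n) k.
    move=> ltk; elim: j => [|j IH]; first by rewrite leqn0 => /eqP ->.
    rewrite leq_eqVlt => /orP[/eqP -> //|]; rewrite ltnS => leij.
    have := SS j n; have -> : n <= j.
      by apply: leq_trans leij; rewrite ltnW // -subn_gt0; exact: leq_ltn_trans ltk.
    move=> [x ->]; rewrite nth_rcons szS IH // (leq_trans ltk) //; exact: leq_sub2r.
  rewrite -[RHS]pre_nth szS; apply/preP => k ltk; rewrite /y.
  have [le|/ltnW le] := leqP i (n + k.+1); first by rewrite (mono i).
  by rewrite (mono (n + k.+1) i k) // addnC addnK.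
have [n [m nm]] : exists n m, f n (y n) <> f m (y m).
  apply: contrapT => h; apply: (dis (f 0 (y 0))) => n; exists (y n) => //.
  by apply: contrapT => ne; apply: h; exists n, 0.
have := polish_hausdorff pT; rewrite open_hausdorff => /(_ _ _ (introN eqP nm)).
move=> [[U V] /= [/set_mem Uf /set_mem Vf] [oU oV UV]].
have [k kU] := continuous_from_baire (@cf n (y n)) (open_nbhs_nbhs (conj oU Uf)).
have [l lV] := continuous_from_baire (@cf m (y m)) (open_nbhs_nbhs (conj oV Vf)).
(* At stage [i] the sequence with index [n] has length [i - n], so this stage reaches past [k] at
   index [n] and past [l] at index [m]. *)
pose i := maxn (k + n) (l + m).
have ki : k <= i - n by rewrite leq_subRL ?(leq_trans (leq_addl k n)) ?leq_maxl // addnC leq_maxl.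
have li : l <= i - m by rewrite leq_subRL ?(leq_trans (leq_addl l m)) ?leq_maxr // addnC leq_maxr.
apply: (nS i).
exists (fun j => [set t | (j = n -> U t) /\ (j = m -> V t)]); split.
- move=> j; apply: borel_and; apply: borel_imp; try exact: borel_cst; exact: borel_open.
- move=> j z; rewrite szS -yS => e; split => ej; subst j.
    by apply: kU; exact: pre_le e.
  by apply: lV; exact: pre_le e.
- move=> t h; have : (U `&` V) t by split; [have [/(_ erefl)] := h n|have [_ /(_ erefl)] := h m].
  by rewrite (eqP UV).
Qed.

End novikov_trees.

Lemma novikov (A : nat -> set T) : (forall n, susl (A n)) ->
  (forall t, ~ forall n, A n t) -> exists B : nat -> set T,
  [/\ forall n, borel (B n), forall n, A n `<=` B n & forall t, ~ forall n, B n t].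
Proof.
move=> sA dA.
(* An empty set is no continuous image of Baire space, and is treated apart. *)
have [[m Am0]|nA] := pselect (exists n, A n = set0).
  exists (fun n => if n == m then set0 else setT); split.
  - by move=> n; case: ifP => _; apply: borel_open; [exact: open0|exact: openT].
  - by move=> n t; case: eqP => [->|//]; rewrite Am0.
  - by move=> t /(_ m); rewrite eqxx.
have /(_ _)/cid2 h n : exists2 f : baire -> T, continuous f & range f = A n.
  by apply: susl_range pT (sA n) _; apply/set0P/eqP => e; apply: nA; exists n.
have [||B [bB fB dB]] := @separated_root (fun n => s2val (h n)).
- by move=> n; case: (h n).
- by move=> t ht; apply: (dA t) => n; have := ht n; case: (h n) => /= f _ <-.
by exists B; split => // n t; have := fB n; case: (h n) => /= f _ <- ht [y _ <-]; exact: ht.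
Qed.

Lemma lusin (A B : set T) : susl A -> susl B -> (forall t, A t -> ~ B t) ->
  exists2 D, borel D & A `<=` D /\ forall t, B t -> ~ D t.
Proof.
move=> sA sB dAB.
have [||D [bD sD dD]] := @novikov (fun n => if n is 0 then A else B).
- by case.
- by move=> t h; apply: (dAB t); [exact: (h 0)|exact: (h 1)].
exists (D 0) => //; split; first exact: (sD 0).
by move=> t Bt D0; apply: (dD t) => -[//|n]; exact: (sD n.+1).
Qed.

Lemma suslin (A : set T) : susl A -> cosusl A -> borel A.
Proof.
move=> sA cA; have [|D bD [AD CD]] := lusin sA cA; first by move=> t At; apply.
rewrite (_ : A = D) //; apply/seteqP; split => // t Dt.
by apply: contrapT => nA; exact: (CD t).
Qed.

End separation.

(** * Projections of Borel sets with finite sections *)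

Section finite_sections.
Variables (R : realType) (T : topologicalType) (pT : polish R T).
Implicit Types G : set (T * baire)%type.

Let pTb : polish R (T * baire)%type.
Proof. exact: polish_prod pT (polish_baire R). Qed.

Definition sect G (t : T) : set baire := [set y | G (t, y)].

(* Separating the disjoint analytic sets {t | exists y in the section, y i = j},
   for fixed i and varying j, yields a Borel map picking the only point. *)
Lemma proj_unique (S : seq (seq nat)) (G : seq nat -> set (T * baire)%type) :
  (forall l, borel (G l)) ->
  (forall t, (forall l, l \in S -> exists y, G l (t, y)) ->
     forall l y y', l \in S -> G l (t, y) -> G l (t, y') -> y = y') ->
  borel [set t | forall l, l \in S -> exists y, G l (t, y)].
Proof.
move=> bG uG.
(* Uniqueness is known only on [full], which so far is merely analytic; the separated sets are
   therefore intersected with it. *)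
pose full t := forall l, l \in S -> exists y, G l (t, y).
have sG l : susl (G l) by exact: borel_susl pTb (bG l).
have sex l (D : set baire) : borel D -> susl [set t | exists y, G l (t, y) /\ D y].
  move=> bD; apply: susl_ex_baire; apply: susl_and.
    by apply: (@susl_preim _ _ (fun p => (p.1, p.2)) _ _ (sG l)); cont.
  by apply: (@susl_preim _ _ snd _ _ (borel_susl (polish_baire R) bD)); cont.
have sfull : susl [set t | full t].
  apply: susl_all => l; rewrite (_ : mkset _ = [set t | l \notin S \/ exists y, G l (t, y) /\ setT y]).
    apply: susl_or; first exact: susl_cst.
    by apply: sex; apply: borel_open; exact: openT.
  apply/seteqP; split => t /=; last by case=> [/negP //|[y [? _]] _]; exists y.
  by case: (boolP (l \in S)) => lS; [move=> /(_ isT)[y ?]; right; exists y|left].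
have bco i (D : set nat) : borel [set y : baire | D (y i)].
  by apply: (@borel_map_coord baire (fun y => y) i D); apply: continuous_borel; cont.
have /(_ _ _ _)/cid2 hD l i j : exists2 D, borel D &
    [set t | full t /\ exists y, G l (t, y) /\ y i = j] `<=` D /\
    forall t, (full t /\ exists y, G l (t, y) /\ y i <> j) -> l \in S -> ~ D t.
  have [lS|lS] := boolP (l \in S); last by exists setT; [apply: borel_open; exact: openT|].
  have [||t [ft [y [Gy e]]] [_ [y' [Gy' ne]]]|D bD [sD dD]] := @lusin R T pT
      [set t | full t /\ exists y, G l (t, y) /\ y i = j]
      [set t | full t /\ exists y, G l (t, y) /\ y i <> j].
  - by apply: susl_and => //; apply: (sex l [set y | y i = j]); exact: (bco i [set j]).
  - by apply: susl_and => //; apply: (sex l [set y | y i <> j]); exact: (bco i [set k | k <> j]).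
  - by apply: ne; rewrite -e (uG t ft l y y').
  by exists D => //; split => // t /dD.
pose D l i j := s2val (hD l i j).
have bD l i j : borel (D l i j) by rewrite /D; case: (hD l i j).
have D1 l i j t : full t -> (exists y, G l (t, y) /\ y i = j) -> D l i j t.
  by move=> ft ey; rewrite /D; case: (hD l i j) => D0 /= _ [h _]; apply: h.
have D2 l i j t : full t -> l \in S -> (exists y, G l (t, y) /\ y i <> j) -> ~ D l i j t.
  by move=> ft lS ey; rewrite /D; case: (hD l i j) => D0 /= _ [_ h]; apply: h.
pose d l (t : T) : baire := fun i => least (fun j => D l i j t).
have dP l t y : full t -> l \in S -> G l (t, y) -> d l t = y.
  move=> ft lS Gy; apply/funext => i.
  have Dy : D l i (y i) t by apply: D1 => //; exists y.
  have Dd := @least_ex (fun j => D l i j t) _ Dy; apply: contrapT => ne.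
  by apply: (D2 l i _ t ft lS _ Dd); exists y; split => // e; apply: ne.
have bd l : borel_map (d l).
  by apply: borel_map_baire => i j; apply: (@borel_least _ (D l i)) => k; exact: bD.
(* Membership in [full] becomes Borel by testing [G l] at the Borel selector [d l]. *)
rewrite (_ : mkset _ = [set t | forall l, l \in S -> G l (t, d l t)]).
  apply: borel_all => l; apply: borel_imp; first exact: borel_cst.
  apply: (borel_map_pair pT (polish_baire R) _ (bd l) (bG l)).
  by apply: continuous_borel; cont.
apply/seteqP; split => t /= h l lS; last by exists (d l t); exact: h.
by have [y Gy] := h l lS; rewrite (dP l t y).
Qed.

Definition atmost n (A : set baire) :=
  forall s : seq baire, uniq s -> {in s, forall y, A y} -> size s <= n.

Lemma uniq_pre (s : seq baire) : uniq s -> exists k, uniq (map (pre^~ k) s).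
Proof.
elim: s => [|x s IH /= /andP[xs /IH[k uk]]]; first by exists 0.
have [m hm] : exists m, forall y, y \in s -> pre x m <> pre y m.
  elim: s xs {IH uk} => [_|y s IH]; first by exists 0.
  rewrite inE negb_or => /andP[nxy /IH[m hm]].
  have [i ne] : exists i, x i <> y i.
    apply: contrapT => h; move/eqP: nxy; apply; apply/funext => i.
    by apply: contrapT => ne; apply: h; exists i.
  exists (maxn m i.+1) => z; rewrite inE => /orP[/eqP -> /preP/(_ i)|zs e].
    by move=> h; apply: ne; apply: h; rewrite leq_maxr.
  by apply: (hm z zs); apply: pre_le e; rewrite leq_maxl.
exists (maxn k m); apply/andP; split.
  apply/mapP => -[y ys e]; apply: (hm y ys); apply: pre_le e; exact: leq_maxr.
rewrite map_inj_in_uniq; first by move: uk => /map_uniq.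
move=> y z ys zs /(pre_le (leq_maxl k m)) e; apply: contrapT => /eqP ne.
move: ys zs uk e ne; clear; elim: s => // a s IH.
rewrite !inE /= => /orP[/eqP->|ys] /orP[/eqP->|zs] /andP[na uk] e; rewrite ?eqxx //.
- by move: na; rewrite e; move/mapP; case; exists z.
- by move: na; rewrite -e; move/mapP; case; exists y.
- exact: IH.
Qed.

(** Induction on the bound. [W] collects the [t] whose section has the maximal number of points,
    told apart by their prefixes of some length; there every prefix selects one point and
    [proj_unique] applies. Off [W] the bound drops by one. *)
Lemma proj_atmost n G : borel G -> (forall t, atmost n (sect G t)) ->
  borel [set t | exists y, G (t, y)].
Proof.
elim: n G => [|n IH] G bG aG.
  rewrite (_ : mkset _ = [set _ | False]); first exact: borel_cst.
  apply/seteqP; split => t // [y Gy]; suff : false by [].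
  by have := aG t [:: y] erefl; rewrite /= ltn0; apply => z; rewrite inE => /eqP ->.
pose W := [set t | exists (k : nat) (S : seq (seq nat)), (uniq S && (size S == n.+1)) /\
   forall l, l \in S -> exists y, G (t, y) /\ pre y k = l].
have bW : borel W.
  apply: borel_ex => k; apply: borel_ex => S.
  have [/andP[uS /eqP sS]|nS] := boolP (uniq S && (size S == n.+1)); last first.
    by rewrite (_ : mkset _ = [set _ | False]); [exact: borel_cst|apply/seteqP; split => t //= []].
  rewrite (_ : mkset _ = [set t | forall l, l \in S -> exists y,
      [set p | G p /\ pre p.2 k = l] (t, y)]); last by apply/seteqP; split => t //= [].
  apply: (@proj_unique S (fun l => [set p | G p /\ pre p.2 k = l])).
    move=> l; apply: borel_and => //; apply: borel_open.
    by apply: (@open_pre _ snd k [set l]); cont.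
  move=> t full l y y' lS [/= Gy ey] [/= Gy' ey']; apply: contrapT => ne.
  have /(_ _)/cid hc l0 : exists z, l0 \in S -> G (t, z) /\ pre z k = l0.
    by case: (boolP (l0 \in S)) => [/full[z ?]|_]; [exists z|exists y].
  pose c l0 := if l0 == l then y else projT1 (hc l0).
  have cP l0 : l0 \in S -> G (t, c l0) /\ pre (c l0) k = l0.
    by rewrite /c; case: eqP => [->|_] //; case: (hc l0).
  (* A second point over [l], added to one point over each of the [n.+1] prefixes, exceeds the
     bound. *)
  suff : false by []; have := aG t (y' :: map c S); rewrite /= size_map sS ltnn; apply.
    apply/andP; split.
      apply/mapP => -[l0 l0S e]; have [_] := cP l0 l0S; rewrite -e ey' => el.
      by apply: ne; rewrite e /c el eqxx.
    rewrite map_inj_in_uniq // => a b aS bS e.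
    by have [_ <-] := cP a aS; have [_ <-] := cP b bS; rewrite e.
  move=> z; rewrite inE => /orP[/eqP -> //|/mapP[l0 l0S ->]].
  by have [] := cP l0 l0S.
rewrite (_ : mkset _ = [set t | W t \/ exists y, (G `\` [set p | W p.1]) (t, y)]).
  apply: borel_or => //; apply: IH.
    apply: borel_and => //; apply: borel_not.
    by apply: (@continuous_borel _ _ fst _ W bW); cont.
  move=> t s us hs; rewrite leqNgt; apply/negP => lt; have [k uk] := uniq_pre us.
  have [y ys] : exists y, y \in s by case: s lt {us hs uk} => // y s; exists y; exact: mem_head.
  have [_ /=] := hs y ys; apply; exists k, (map (pre^~ k) s); split.
    rewrite uk size_map eqn_leq lt andbT; apply: (aG t) => // z /hs [].
    by [].
  by move=> l /mapP[z zs ->]; exists z; split => //; have [] := hs z zs.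
apply/seteqP; split => t /=.
  by move=> [y Gy]; have [Wt|nW] := pselect (W t); [left|right; exists y].
move=> [[k [S [/andP[_ /eqP]]]]|[y []]]; last by exists y.
by case: S => // l S _ /(_ l (mem_head _ _))[y [Gy _]]; exists y.
Qed.

(** The analytic sets [A n] of points with more than [n] elements in the section have empty
    intersection. The theorem of Novikov encloses them in Borel sets with empty intersection, and
    off the [n]-th of these [proj_atmost] applies. *)
Lemma proj_finite G : borel G -> (forall t, finite_set (sect G t)) ->
  borel [set t | exists y, G (t, y)].
Proof.
move=> bG fG.
pose A n := [set t | exists b, (forall i, i <= n -> G (t, bcol i b)) /\
  forall i j, i < j -> j <= n -> bcol i b <> bcol j b].
have [n|t h|B [bB AB dB]] := @novikov R T pT A.
- apply: susl_ex_baire; apply: (borel_susl pTb); apply: borel_and.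
    apply: borel_all => i; apply: borel_imp; first exact: borel_cst.
    by apply: (@continuous_borel _ _ (fun p => (p.1, bcol i p.2)) _ _ bG); rewrite /bcol; cont.
  apply: borel_all => i; apply: borel_all => j.
  apply: borel_imp; first exact: borel_cst.
  apply: borel_imp; first exact: borel_cst.
  apply: borel_not; apply: borel_closed; apply: closed_eq_fun hausdorff_baire _ _;
    rewrite /bcol; cont.
- have [s es] := (finite_seqP (sect G t)).1 (fG t).
  have [b [Gb db]] := h (size s).
  pose m := [seq bcol i b | i <- iota 0 (size s).+1].
  have um : uniq m.
    rewrite map_inj_in_uniq ?iota_uniq // => i j; rewrite !mem_iota /= !add0n !ltnS => li lj e.
    by case: (ltngtP i j) => // lt; [case: (db i j)|case: (db j i)].
  have sm : {subset m <= s}.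
    move=> y /mapP[i]; rewrite mem_iota add0n ltnS /= => li ->.
    by have := Gb i li; rewrite -[G _]/(sect G t _) es.
  by have := uniq_leq_size um sm; rewrite size_map size_iota ltnn.
rewrite (_ : mkset _ = [set t | exists n, exists y, (G `\` [set p | B n p.1]) (t, y)]).
  apply: borel_ex => n; apply: (@proj_atmost n).
    apply: borel_and => //; apply: borel_not.
    by apply: (@continuous_borel _ _ fst _ (B n) (bB n)); cont.
  move=> t s us hs; rewrite leqNgt; apply/negP => lt.
  have [y ys] : exists y, y \in s by case: s lt {us hs} => // y s; exists y; exact: mem_head.
  have [_ /=] := hs y ys; apply; apply: AB; exists (bglue (nth y s)); split.
    move=> i lei; rewrite bcol_bglue; suff /hs[] : nth y s i \in s by [].
    by apply: mem_nth; exact: leq_ltn_trans lt.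
  move=> i j ltij lej; rewrite !bcol_bglue => /eqP.
  rewrite nth_uniq //; first by move=> /eqP e; move: ltij; rewrite e ltnn.
    by apply: ltn_trans ltij _; exact: leq_ltn_trans lt.
  exact: leq_ltn_trans lt.
apply/seteqP; split => t /=; last by move=> [n [y []]]; exists y.
move=> [y Gy]; apply: contrapT => h; apply: (dB t) => n; apply: contrapT => nB.
by apply: h; exists n, y.
Qed.

End finite_sections.

(** * Transfer to the Baire space *)

Lemma salgebra_prod_preim (X X' : Type) (S : set_system X) (S' : set_system X') (h : X -> X') :
  (forall A, S' A -> S (h @^-1` A)) -> forall A, prod_salgebra S' A ->
  prod_salgebra S [set p | A (h p.1, h p.2)].
Proof.
move=> hS A hA; apply: (hA [set A | prod_salgebra S [set p | A (h p.1, h p.2)]]).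
split => [|_ [B SB [C SC <-]]].
  split=> [|B bB|B bB]; rewrite /mkset /=.
  - exact: sigma_algebra0.
  - rewrite (_ : (fun _ => _) = setT `\` [set p : X * X | B (h p.1, h p.2)]).
      exact: sigma_algebraCD.
    by apply/seteqP; split => p /= => [[]|[]].
  - rewrite (_ : (fun _ => _) = \bigcup_k [set p : X * X | B k (h p.1, h p.2)]).
      exact: sigma_algebra_bigcup.
    by apply/seteqP; split => p [k ? ?]; exists k.
apply: sub_sigma_algebra; exists (h @^-1` B); first exact: hS.
by exists (h @^-1` C) => //; exact: hS.
Qed.

Section fber_baire.
Variable R : realType.

Lemma fberE (T : topologicalType) (A : set (T * T)) : polish R T ->
  fber (@borel T) A <->
  [/\ borel A, Equivalence (fun x y => A (x, y)) & forall x, finite_set [set y | A (x, y)]].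
Proof. by move=> pT; rewrite /fber /borel_equiv (prod_salgebraE pT); split=> [[[]]|[]]. Qed.

(** The relations are carried along the injection [th] with left inverse [ka], and extended by
    equality off the range of [th]. This range is Borel, being the set of fixed points of
    [th \o ka]. *)
Lemma hyperfinite_transfer :
  (exists (X : Type) (S : set_system X) (E : set (X * X)),
     [/\ standard_borel R S, cber S E, hyperhyperfinite S E & ~ hyperfinite S E]) ->
  exists F : nat -> nat -> set (baire * baire),
    [/\ forall n m, fber (@borel baire) (F n m),
        forall n m, F n m `<=` F n m.+1,
        forall n m p, F n m p -> exists m', F n.+1 m' p
      & ~ hyperfinite (@borel baire) [set p | exists n m, F n m p]].
Proof.
move=> [X [S [E [[Y [f [pY [g fg gf] eS]]] cE [Fn [cFn [incF eE]]] nE]]]].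
have [nY|[q [e [cq be qe]]]] := polish_cases pY.
  (* On the empty space [E] is itself finite. *)
  exfalso; apply: nE; exists (fun _ => E); split; last first.
    split; first by move=> n p.
    by apply/seteqP; split=> p; [exists 0|case].
  by move=> _; split; [case: cE|move=> x; case: (nY (f x))].
pose th x := e (f x); pose ka a := g (q a).
have kath : cancel th ka by move=> x; rewrite /th /ka qe fg.
have thka a : th (ka a) = e (q a) by rewrite /th /ka gf.
pose im (A : set (X * X)) : set (baire * baire) :=
  [set p | p.1 = p.2 \/ (th (ka p.1) = p.1 /\ th (ka p.2) = p.2) /\ A (ka p.1, ka p.2)].
have bth : borel [set a | th (ka a) = a].
  rewrite (_ : mkset _ = [set a : baire | forall i, exists j, e (q a) i = j /\ a i = j]).
    have beq : borel_map (fun a => e (q a)).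
      exact: (borel_map_comp (continuous_borel cq) be).
    apply: borel_all => i; apply: borel_ex => j; apply: borel_and.
      exact: (@borel_map_coord _ (fun a => e (q a)) i [set j] beq).
    by apply: (@borel_map_coord _ (fun a => a) i [set j]); apply: continuous_borel; cont.
  apply/seteqP; split => a /=; rewrite thka; first by move=> -> i; exists (a i).
  by move=> h; apply/funext => i; have [j [-> ->]] := h i.
have bim A : prod_salgebra S A -> borel (im A).
  move=> SA; apply: borel_or.
    apply: borel_closed; apply: closed_eq_fun hausdorff_baire _ _; cont.
  apply: borel_and; first apply: borel_and.
  - by apply: (@continuous_borel _ _ fst _ _ bth); cont.
  - by apply: (@continuous_borel _ _ snd _ _ bth); cont.
  rewrite -(prod_salgebraE (polish_baire R)).
  apply: salgebra_prod_preim SA => A'; rewrite eS => -[B bB <-].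
  rewrite (_ : _ @^-1` _ = q @^-1` B); first exact: (continuous_borel cq bB).
  by apply/seteqP; split => a /=; rewrite /ka gf.
have fim A : fber S A -> fber (@borel baire) (im A).
  move=> [[SA [rA sA tA]] fA]; apply/(fberE _ (polish_baire R)); split; first exact: bim.
    split=> [a|a b|a b c]; rewrite /im /=; first by left.
      by move=> [->|[[h1 h2] /sA h3]]; [left|right].
    move=> [->//|[[h1 h2] h3]] [<-|[[h4 h5] h6]]; first by right.
    by right; split => //; exact: tA h3 h6.
  move=> a; apply: (@sub_finite_set _ _ ([set a] `|` th @` [set y | A (ka a, y)])).
    move=> b; rewrite /im /= => -[->|[[_ h2] h3]]; first by left.
    by right; exists (ka b).
  by rewrite finite_setU; split; [exact: finite_set1|exact: finite_image].
have /(_ _)/cid hF n : hyperfinite S (Fn n) by case: (cFn n).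
pose F n := projT1 (hF n).
have fF n m : fber S (F n m) by rewrite /F; case: (hF n) => /= F0 [].
have iF n : (forall m, F n m `<=` F n m.+1) by rewrite /F; case: (hF n) => /= F0 [_ []].
have uF n p : Fn n p <-> exists m, F n m p.
  rewrite /F; case: (hF n) => /= F0 [_ [_ ->]].
  by split=> [[m _]|[m]]; exists m.
have EF p : E p <-> exists n m, F n m p.
  rewrite eE; split; first by move=> [n _ /uF[m]]; exists n, m.
  by move=> [n [m h]]; exists n => //; apply/uF; exists m.
exists (fun n m => im (F n m)); split.
- by move=> n m; exact: fim.
- by move=> n m [a b] /= [|[h1 /iF]]; [left|right].
- move=> n m [a b]; rewrite /im /= => -[->|[h1 h2]]; first by exists 0; left.
  have /incF/uF[m' h3] : Fn n (ka a, ka b) by apply/uF; exists m.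
  by exists m'; right.
move=> [G [fG [iG eG]]]; apply: nE; exists (fun n => [set p | G n (th p.1, th p.2)]).
have thS A : borel A -> S (th @^-1` A) by move=> bA; rewrite eS; exists (e @^-1` A) => //; exact: be.
split; last split.
- move=> n; have [[SG [rG sG tG]] finG] := fG n; split; last first.
    move=> x; rewrite (_ : mkset _ = th @^-1` [set b | G n (th x, b)]) //.
    by apply: finite_preimage => //; apply: in2W; exact: can_inj kath.
  split; first exact: salgebra_prod_preim SG.
  by split=> [x|x y|x y z] /=; [exact: rG|exact: sG|exact: tG].
- by move=> n p /=; exact: iG.
- apply/seteqP; split => -[x y] /=.
    move=> /EF[n [m h]].
    have : [set p | exists n m, im (F n m) p] (th x, th y).
      by exists n, m; right; rewrite /= !kath.
    by rewrite eG.
  move=> [n _ /= h]; apply/EF.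
  have : (\bigcup_n G n) (th x, th y) by exists n.
  rewrite -eG => -[k [m [/= /(can_inj kath) <-|[_]]]]; last by rewrite /= !kath; exists k, m.
  by exists 0, 0; have [[_ [rF _ _]] _] := fF 0 0; exact: rF.
Qed.

End fber_baire.

(** * Hyperfinite approximations along a real *)

Lemma finite_set_bound (T : choiceType) (A : set T) (P : T -> nat -> Prop) : finite_set A ->
  (forall y, A y -> exists m0, forall m, m0 <= m -> P y m) ->
  exists m0, forall m, m0 <= m -> forall y, A y -> P y m.
Proof.
move=> /finite_seqP[s ->]; elim: s => [|a s IH] h; first by exists 0.
have [m0 h0] := IH (fun y ys => h y (mem_behead (s := a :: s) ys)).
have [m1 h1] := h a (mem_head _ _).
exists (maxn m0 m1) => m; rewrite geq_max => /andP[l0 l1] y /=.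
by rewrite inE => /orP[/eqP ->|]; [exact: h1|exact: h0].
Qed.

Section approximation.
Variable R : realType.
Variable F : nat -> nat -> set (baire * baire).
Hypothesis fF : forall n m, fber (@borel baire) (F n m).
Hypothesis Fm : forall n m, F n m `<=` F n m.+1.
Hypothesis FS : forall n m p, F n m p -> exists m', F n.+1 m' p.

Local Notation pb := (polish_baire R).

Definition Eall : set (baire * baire) := [set p | exists n m, F n m p].

Lemma borel_F n m : borel (F n m). Proof. by have /(fberE _ pb)[] := fF n m. Qed.
Lemma finite_F n m x : finite_set [set y | F n m (x, y)]. Proof. by have [] := fF n m. Qed.
Lemma Frefl n m x : F n m (x, x). Proof. by have [[_ [h _ _]] _] := fF n m. Qed.
Lemma Fsym n m x y : F n m (x, y) -> F n m (y, x).
Proof. by have [[_ [_ h _]] _] := fF n m; exact: h. Qed.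
Lemma Ftrans n m x y z : F n m (x, y) -> F n m (y, z) -> F n m (x, z).
Proof. by have [[_ [_ _ h]] _] := fF n m; exact: h. Qed.

Lemma Fm_le n m m' p : m <= m' -> F n m p -> F n m' p.
Proof. by move=> /subnKC <-; elim: (m' - m) => [|k IH]; rewrite ?addn0 // addnS => /IH/Fm. Qed.

Lemma Fn_le n n' m p : n <= n' -> F n m p -> exists m', F n' m' p.
Proof.
move=> /subnKC <- h; elim: (n' - n) => [|k [m' IH]]; first by rewrite addn0; exists m.
by rewrite addnS; exact: FS IH.
Qed.

Lemma Eall_equiv : Equivalence (fun x y => Eall (x, y)).
Proof.
split=> [x|x y [n [m h]]|x y z [n [m h]] [n' [m' h']]].
- by exists 0, 0; exact: Frefl.
- by exists n, m; exact: Fsym.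
- have [k hk] := Fn_le (leq_maxl n n') h; have [k' hk'] := Fn_le (leq_maxr n n') h'.
  exists (maxn n n'), (maxn k k').
  by apply: (Ftrans (Fm_le (leq_maxl k k') hk)); exact: Fm_le (leq_maxr k k') hk'.
Qed.

(* The history is stored in reverse order: [m :: t] is the step taken at
   stage [size t] after the history [t]. A step with value [m] merges the
   classes of [Happ t] that lie in a single [F (size t) m]-class. *)
Fixpoint Happ (t : seq nat) : set (baire * baire) :=
  if t is m :: t' then
    let A x := forall x', Happ t' (x, x') -> F (size t') m (x, x') in
    [set p | Happ t' p \/ (A p.1 /\ A p.2) /\ F (size t') m p]
  else [set p | p.1 = p.2].

(** The failure set is the projection of a Borel set with finite sections. Quantifiers over finite
    classes thus stay Borel. *)
Lemma borel_all_finite (T : topologicalType) (G P : set (T * baire)) : polish R T ->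
  borel G -> borel P -> (forall t, finite_set (sect G t)) ->
  borel [set t | forall y, G (t, y) -> P (t, y)].
Proof.
move=> pT bG bP finG.
rewrite (_ : mkset _ = [set t | ~ exists y, (G `\` P) (t, y)]).
  apply: borel_not; apply: (proj_finite pT).
    by apply: borel_and => //; exact: borel_not.
  by move=> t; apply: sub_finite_set (finG t) => y [].
apply/seteqP; split => t /= h; first by move=> [y [/h]].
by move=> y Gy; apply: contrapT => nP; apply: h; exists y.
Qed.

Lemma Happ_fber t : fber (@borel baire) (Happ t).
Proof.
elim: t => [|m t IH]; apply/(fberE _ pb).
  split.
  - by apply: borel_closed; apply: closed_eq_fun hausdorff_baire _ _; cont.
  - by split=> [x|x y|x y z] //=; move=> ->.
  - by move=> x; rewrite (_ : mkset _ = [set x]) //; apply/seteqP; split => y /=.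
have /(fberE _ pb)[bH [rH sH tH] finH] := IH.
rewrite /=; pose A x := forall x', Happ t (x, x') -> F (size t) m (x, x').
have bA : borel [set x | A x] by apply: borel_all_finite => //; [exact: pb|exact: borel_F].
(* The condition for merging is invariant under the old relation; hence whole classes are merged and
   transitivity survives. *)
have Ainv x y : A x -> Happ t (x, y) -> A y.
  move=> Ax h z h'; apply: (@Ftrans _ _ _ x); first by apply: Fsym; exact: Ax.
  by apply: Ax; exact: tH h h'.
split.
- apply: borel_or => //; apply: borel_and; last exact: borel_F.
  by apply: borel_and; [apply: (@continuous_borel _ _ fst _ _ bA)|
    apply: (@continuous_borel _ _ snd _ _ bA)]; cont.
- split=> [x|x y|x y z] /=; first by left; exact: rH.
    by move=> [/sH|[[h1 h2] /Fsym h3]]; [left|right].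
  move=> [h|[[h1 h2] h3]] [h'|[[h1' h2'] h3']].
  + by left; exact: tH h h'.
  + right; have Ax : A x by apply: Ainv h1' _; exact: sH.
    by split => //; apply: Ftrans h3'; exact: Ax.
  + right; have Az : A z by exact: Ainv h2 h'.
    by split => //; apply: Ftrans h3 _; exact: h2.
  + by right; split => //; exact: Ftrans h3 h3'.
- move=> x; apply: (@sub_finite_set _ _ ([set y | Happ t (x, y)] `|` [set y | F (size t) m (x, y)])).
    by move=> y /= [|[_]]; [left|right].
  by rewrite finite_setU; split => //; exact: finite_F.
Qed.

Lemma borel_Happ t : borel (Happ t). Proof. by have /(fberE _ pb)[] := Happ_fber t. Qed.
Lemma finite_Happ t x : finite_set [set y | Happ t (x, y)].
Proof. by have [] := Happ_fber t. Qed.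

Lemma Happ_mono m t : Happ t `<=` Happ (m :: t).
Proof. by move=> p h; left. Qed.

Lemma Happ_sub t p : Happ t p -> exists m, F (size t) m p.
Proof.
elim: t p => [|m t IH] [x y] /=; first by move=> ->; exists 0; exact: Frefl.
by move=> [/IH[m' /FS]|[_ /FS]].
Qed.

(** These sets increase to [Eall] and have finite sections, but need not be transitive. *)
Definition Gapp k : set (baire * baire) :=
  [set p | exists i j, (i <= k /\ j <= k) /\ F i j p].

Lemma borel_Gapp k : borel (Gapp k).
Proof.
apply: borel_ex => i; apply: borel_ex => j; apply: borel_and; [exact: borel_cst|exact: borel_F].
Qed.

Lemma finite_Gapp k x : finite_set [set y | Gapp k (x, y)].
Proof.
apply: (@sub_finite_set _ _ (\bigcup_(i in `I_k.+1) \bigcup_(j in `I_k.+1) [set y | F i j (x, y)])).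
  by move=> y [i [j [[li lj] h]]]; exists i => //; exists j.
apply: bigcup_finite; first exact: finite_II.
by move=> i _; apply: bigcup_finite; [exact: finite_II|move=> j _; exact: finite_F].
Qed.

(** A good step merges with [x] every point that [Gapp (size t)] relates to it. *)
Definition good (t : seq nat) m (x : baire) :=
  forall y, Gapp (size t) (x, y) -> F (size t) m (x, y) /\
    forall y', Happ t (y, y') -> F (size t) m (y, y').

Lemma borel_good t m : borel [set x | good t m x].
Proof.
have bA : borel [set y | forall y', Happ t (y, y') -> F (size t) m (y, y')].
  by apply: borel_all_finite; [exact: pb|exact: borel_Happ|exact: borel_F|exact: finite_Happ].
apply: (@borel_all_finite _ (Gapp (size t)) [set p | F (size t) m p /\
  forall y', Happ t (p.2, y') -> F (size t) m (p.2, y')] pb).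
- exact: borel_Gapp.
- by apply: borel_and; [exact: borel_F|apply: (@continuous_borel _ _ snd _ _ bA); cont].
- exact: finite_Gapp.
Qed.

(** Goodness concerns finitely many pairs, each of which lies in [F (size t) m] for all large [m].
    So the bad values are bounded, which is what makes [Xdom_wf] a compactness argument. *)
Lemma good_large t x : exists m0, forall m, m0 <= m -> good t m x.
Proof.
apply: finite_set_bound; first exact: finite_Gapp.
move=> y [i [j [[li lj] h]]]; have [m1 h1] := Fn_le li h.
have [|m2 h2] := @finite_set_bound _ _ (fun y' m => F (size t) m (y, y')) (finite_Happ t y).
  by move=> y' /= /Happ_sub[m h']; exists m => m' le; exact: Fm_le h'.
exists (maxn m1 m2) => m; rewrite geq_max => /andP[l1 l2]; split; first exact: Fm_le h1.
by move=> y'; exact: h2.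
Qed.

Lemma good_Happ (u : baire) x y :
  (forall k0, exists2 k, k0 <= k & good (rev (pre u k)) (u k) x) -> Eall (x, y) ->
  exists n, Happ (rev (pre u n)) (x, y).
Proof.
move=> hx [i [j h]]; have [k lek gk] := hx (maxn i j).
exists k.+1; rewrite preS rev_rcons /=; right.
have szk : size (rev (pre u k)) = k by rewrite size_rev size_pre.
have Gxy : Gapp (size (rev (pre u k))) (x, y).
  exists i, j; rewrite szk; split => //; move: lek; rewrite geq_max => /andP[]; by [].
have Gxx : Gapp (size (rev (pre u k))) (x, x) by exists 0, 0; split => //; exact: Frefl.
by have [h1 h2] := gk y Gxy; have [_ h3] := gk x Gxx.
Qed.

(** The domain attached to a tree [z]: everything if [z] has no branch, while
    a branch of [z] witnesses hyperfiniteness on it. *)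
Definition Xdom (z : set (seq nat)) (x : baire) := forall t : seq nat, exists n,
  size t <= n /\ forall s, size s = n -> take (size t) s = t -> z s ->
  exists k, (size t <= k < n) /\ good (rev (take k s)) (nth 0 s k) x.

Lemma Xdom_branch (z : set (seq nat)) u x : (forall n, z (pre u n)) -> Xdom z x ->
  forall k0, exists2 k, k0 <= k & good (rev (pre u k)) (u k) x.
Proof.
move=> zu Xx k0; have [n [len]] := Xx (pre u k0); rewrite size_pre in len * => h.
have [|k [/andP[k0k ltkn] gk]] := h (pre u n) (size_pre u n) _ (zu n).
  exact: take_pre.
by exists k => //; move: gk; rewrite take_pre ?(ltnW ltkn) // nth_mkseq.
Qed.

(** If the condition fails at [t], there are nodes of [z] above [t] of every length all of whose
    steps after [t] are bad for [x]. By [good_large] such nodes branch finitely, and the lemma of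
    König yields a branch of [z]. *)
Lemma Xdom_wf (z : set (seq nat)) x : (forall s i, z (rcons s i) -> z s) ->
  ~ (exists u, forall n, z (pre u n)) -> Xdom z x.
Proof.
move=> tz wz; apply: contrapT => /existsNP[t ht].
pose bad s := [/\ size t <= size s, take (size t) s = t, z s &
  forall k, size t <= k < size s -> ~ good (rev (take k s)) (nth 0 s k) x].
have zt := closed_take tz.
have badt s n : size t <= n -> bad s -> n <= size s -> bad (take n s).
  move=> ltn [h1 h2 h3 h4] len; have szt : size (take n s) = n by exact: size_takel.
  split; rewrite ?szt //; first by rewrite take_takel.
    exact: zt.
  move=> k /andP[h5 h6]; rewrite take_takel ?(ltnW h6) // nth_take //.
  by apply: h4; rewrite h5 (leq_trans h6).
pose ext s := forall n, size s <= n -> exists s', [/\ bad s', size s' = n & take (size s) s' = s].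
have ext0 : ext t.
  move=> n len; apply: contrapT => h; apply: ht; exists n; split => // s ss ts zs.
  apply: contrapT => h'; apply: h; exists s; split => //; split; rewrite ?ss //.
  by move=> k hk gk; apply: h'; exists k.
have step s : size t <= size s -> ext s -> exists i, ext (rcons s i).
  move=> lts es; have [m0 gm] := good_large (rev s) x.
  apply: contrapT => h.
  have /(_ _)/cid hn i : exists n, size (rcons s i) <= n /\
      ~ exists s', [/\ bad s', size s' = n & take (size (rcons s i)) s' = rcons s i].
    apply: contrapT => h'; apply: h; exists i => n len; apply: contrapT => h''.
    by apply: h'; exists n.
  pose N i := projT1 (hn i).
  have N1 i : size s < N i by rewrite /N; case: (hn i) => /= n []; rewrite size_rcons.
  have N2 i : ~ exists s', [/\ bad s', size s' = N i & take (size s).+1 s' = rcons s i].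
    by rewrite /N; case: (hn i) => /= n [_]; rewrite size_rcons.
  (* If no child of [s] had bad extensions of all lengths, child [i] would fail at length [N i]. A
     bad extension of length [M] must pass through some child [i < m0], since larger values are
     good, and its truncation to [N i] contradicts this. *)
  pose M := maxn (size s).+1 (\max_(i < m0) N i).
  have [s' [bs' ss' ts']] := es M (leq_trans (leqnSn _) (leq_maxl _ _)).
  have lts' : size s < size s' by rewrite ss' leq_maxl.
  pose i := nth 0 s' (size s).
  have ltim : i < m0.
    rewrite ltnNge; apply/negP => /gm gi; have [_ _ _ /(_ (size s))] := bs'.
    by rewrite lts lts' ts'; apply.
  have leN : N i <= size s'.
    by rewrite ss' leq_max; apply/orP; right; exact: (leq_bigmax (Ordinal ltim)).
  apply: (N2 i); exists (take (N i) s'); split.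
  - by apply: badt => //; apply: leq_trans lts _; exact/ltnW/N1.
  - exact: size_takel.
  - by rewrite take_takel; [rewrite (take_nth 0) // ts'|exact: N1].
have [|s [lts es]|u hu] := @branch_extend (fun s => size t <= size s /\ ext s) t.
- by split.
- by have [i ei] := step s lts es; exists i; rewrite size_rcons (leq_trans lts).
apply: wz; exists u => n; have [s [_ es] [_ <-]] := hu n.
have [s' [[_ _ zs' _] ss' ts']] := es _ (leqnn _).
by apply: (zt); rewrite -ts'; exact: zt.
Qed.

End approximation.

(** * Coanalytic sets *)

Section cosusl_calculus.
Variables (R : realType) (T : topologicalType).

Lemma cosuslE (P : T -> Prop) : cosusl [set t | P t] = susl [set t | ~ P t].
Proof. by []. Qed.

Lemma cosusl_all (I : countType) (P : I -> T -> Prop) :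
  (forall i, cosusl [set t | P i t]) -> cosusl [set t | forall i, P i t].
Proof.
move=> cP; rewrite cosuslE (_ : mkset _ = [set t | exists i, ~ P i t]); first exact: susl_ex.
by apply/seteqP; split => t /=; [move/existsNP|move=> [i ni] /(_ i)].
Qed.

Lemma cosusl_ex (I : countType) (P : I -> T -> Prop) :
  (forall i, cosusl [set t | P i t]) -> cosusl [set t | exists i, P i t].
Proof.
move=> cP; rewrite cosuslE (_ : mkset _ = [set t | forall i, ~ P i t]); first exact: susl_all.
by apply/seteqP; split => t /=; [move/forallNP|move=> h [i /h]].
Qed.

Lemma cosusl_and (P Q : T -> Prop) :
  cosusl [set x | P x] -> cosusl [set x | Q x] -> cosusl [set x | P x /\ Q x].
Proof.
move=> cP cQ; rewrite cosuslE (_ : mkset _ = [set t | ~ P t \/ ~ Q t]); first exact: susl_or.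
by apply/seteqP; split => t /=; [move/not_andP|move=> [h|h] []].
Qed.

Lemma cosusl_imp (P Q : T -> Prop) :
  susl [set x | P x] -> cosusl [set x | Q x] -> cosusl [set x | P x -> Q x].
Proof.
move=> sP cQ; rewrite cosuslE (_ : mkset _ = [set t | P t /\ ~ Q t]); first exact: susl_and.
by apply/seteqP; split => t /=; [move/not_implyP|move=> [p nq] /(_ p)].
Qed.

Lemma cosusl_all_polish (Y : topologicalType) (P : T -> Y -> Prop) : polish R Y ->
  cosusl [set p : T * Y | P p.1 p.2] -> cosusl [set t | forall y, P t y].
Proof.
move=> pY cP; rewrite cosuslE (_ : mkset _ = [set t | exists y, ~ P t y]).
  exact: (susl_ex_polish pY).
by apply/seteqP; split => t /=; [move/existsNP|move=> [i ni] /(_ i)].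
Qed.

Lemma cosusl_preim (U : topologicalType) (f : T -> U) (A : set U) :
  continuous f -> cosusl A -> cosusl [set t | A (f t)].
Proof. by move=> cf cA; rewrite cosuslE; exact: (susl_preim cf cA). Qed.

Lemma borel_cosusl (A : set T) : polish R T -> borel A -> cosusl A.
Proof. by move=> pT bA; apply: (borel_susl pT); exact: borelC. Qed.

(** A section is infinite when it has [n.+1] distinct members for every [n]; the members are coded
    as columns of one real, so this is an analytic condition. *)
Lemma cosusl_finite (X : topologicalType) (A : T -> X -> X -> Prop) : polish R X ->
  susl [set p : T * (X * X) | A p.1 p.2.1 p.2.2] ->
  cosusl [set t | forall x, finite_set [set y | A t x y]].
Proof.
move=> pX sA; have [nX|[q [e [cq _ qe]]]] := polish_cases pX.
  rewrite cosuslE (_ : mkset _ = [set _ | False]); first exact: susl_cst.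
  by apply/seteqP; split => t //= h; case: h => x; case: (nX x).
rewrite cosuslE (_ : mkset _ = [set t | exists x, forall n, exists b,
    (forall i j, i < j -> j <= n -> q (bcol i b) <> q (bcol j b)) /\
    forall k, k <= n -> A t x (q (bcol k b))]).
  apply: (susl_ex_polish pX); apply: susl_all => n; apply: susl_ex_baire; apply: susl_and.
    have bo : borel [set b | forall i j, i < j -> j <= n -> q (bcol i b) <> q (bcol j b)].
      apply: borel_all => i; apply: borel_all => j.
      apply: borel_imp; first exact: borel_cst.
      apply: borel_imp; first exact: borel_cst.
      apply: borel_not; apply: borel_closed.
      by apply: closed_eq_fun (polish_hausdorff pX) _ _; rewrite /bcol; cont.
    by apply: (@susl_preim _ _ snd _ _ (borel_susl (polish_baire R) bo)); cont.
  apply: susl_all => k; have [le|nle] := boolP (k <= n); last first.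
    rewrite (_ : mkset _ = [set _ | True]); first exact: susl_cst.
    by apply/seteqP; split.
  rewrite (_ : mkset _ = [set p : T * X * baire | A p.1.1 p.1.2 (q (bcol k p.2))]).
    apply: (@susl_preim _ _ (fun p : T * X * baire => (p.1.1, (p.1.2, q (bcol k p.2)))) _ _ sA).
    by rewrite /bcol; cont.
  by apply/seteqP; split=> p /= h; [exact: h|move=> _].
apply/seteqP; split => t /=.
  move=> /existsNP[x infx]; exists x => n.
  have [s [us ss sA']] : exists s : seq X, [/\ uniq s, size s = n.+1 & {in s, forall y, A t x y}].
    elim: n.+1 => [|m [s [us ss hs]]]; first by exists [::].
    have [y Ay ys] : exists2 y, A t x y & y \notin s.
      apply: contrapT => h; apply: infx; apply/finite_seqP; exists s.
      apply/seteqP; split=> y /=; last exact: hs.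
      by move=> Ay; apply: contrapT => /negP ys; apply: h; exists y.
    exists (y :: s); split; rewrite /= ?ys ?ss // => z.
    by rewrite inE => /orP[/eqP -> //|]; exact: hs.
  exists (bglue (fun i => e (nth x s i))); split=> [i j ltij lej|k lek]; rewrite !bcol_bglue !qe.
    have ltj : j < size s by rewrite ss ltnS.
    move=> /eqP; rewrite nth_uniq //; last exact: ltn_trans ltj.
    by move=> /eqP e'; move: ltij; rewrite e' ltnn.
  by apply: sA'; apply: mem_nth; rewrite ss ltnS.
move=> [x hx] /(_ x)/finite_seqP[s es]; have [b [db Ab]] := hx (size s).
pose m := [seq q (bcol i b) | i <- iota 0 (size s).+1].
have um : uniq m.
  rewrite map_inj_in_uniq ?iota_uniq // => i j; rewrite !mem_iota /= !add0n !ltnS => li lj e'.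
  by case: (ltngtP i j) => // lt; [case: (db i j)|case: (db j i)].
have sm : {subset m <= s}.
  move=> y /mapP[i]; rewrite mem_iota add0n ltnS /= => li ->.
  by have := Ab i li; rewrite -[A _ _ _]/([set y | A t x y] _) es.
by have := uniq_leq_size um sm; rewrite size_map size_iota ltnn.
Qed.

End cosusl_calculus.

(** * Hyperfiniteness witnesses *)

Section witnesses.
Variables (R : realType) (K : borel_coding R) (X : topologicalType).
Hypothesis pX : polish R X.
Local Notation XX := (X * X)%type.
Local Notation A c p := (@codedA R K XX (c, p)).

Let pXX : polish R XX. Proof. exact: polish_prod. Qed.

(** The relation being exhausted is not mentioned; the union of the coded relations is compared with
    it separately. *)
Definition wit (b : baire) := forall n, BC K XX (bcol n b) /\
  (fber (@borel X) [set p | A (bcol n b) p] /\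
   forall p, A (bcol n b) p -> A (bcol n.+1 b) p).

Lemma susl_codedA (T : topologicalType) (f : T -> baire) (g : T -> XX) :
  continuous f -> continuous g -> susl [set t | A (f t) (g t)].
Proof.
move=> cf cg.
have sA := analytic_susl (polish_prod (polish_baire R) pXX) (codedA_analytic K pXX).
by apply: (@susl_preim _ _ (fun t => (f t, g t)) _ _ sA); cont.
Qed.

(** [D] is the coanalytic form of membership. In a coanalytic condition it stands at positive
    occurrences, where the analytic [codedA] is not allowed. *)
Lemma cosusl_codedA : exists D : set (baire * XX),
  (forall c p, BC K XX c -> A c p <-> D (c, p)) /\
  forall (T : topologicalType) (f : T -> baire) (g : T -> XX),
  continuous f -> continuous g -> cosusl [set t | D (f t, g t)].
Proof.
have [D cD hD] := codedA_coanalytic K pXX; exists D; split => // T f g cf cg.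
have sD := analytic_susl (polish_prod (polish_baire R) pXX) cD.
by apply: (@cosusl_preim _ _ (fun t => (f t, g t)) _ _ sD); cont.
Qed.

Lemma cosusl_BC (T : topologicalType) (f : T -> baire) :
  continuous f -> cosusl [set t | BC K XX (f t)].
Proof.
move=> cf; have sB := analytic_susl (polish_baire R) (BC_coanalytic K pXX).
exact: (@cosusl_preim _ _ f _ cf sB).
Qed.

(** Borelness of the columns comes with their being codes. The other clauses are rewritten with [A]
    in hypotheses and [D] in conclusions, the two agreeing on codes. *)
Lemma cosusl_wit : cosusl [set b | wit b].
Proof.
have [D [AD cD]] := cosusl_codedA.
rewrite (_ : mkset _ = [set b | forall n, BC K XX (bcol n b) /\ (
    ((forall x, D (bcol n b, (x, x))) /\
    ((forall x y, A (bcol n b) (x, y) -> D (bcol n b, (y, x))) /\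
    (forall x y z, A (bcol n b) (x, y) -> A (bcol n b) (y, z) -> D (bcol n b, (x, z))))) /\
    ((forall x, finite_set [set y | A (bcol n b) (x, y)]) /\
    (BC K XX (bcol n.+1 b) /\
     forall p, A (bcol n b) p -> D (bcol n.+1 b, p))))]).
  have cb n : continuous (bcol n) by exact: cont_reidx.
  apply: cosusl_all => n; apply: cosusl_and; first by apply: cosusl_BC; exact: cb.
  apply: cosusl_and; last apply: cosusl_and; last apply: cosusl_and.
  - apply: cosusl_and; last apply: cosusl_and.
    + by apply: (cosusl_all_polish pX); apply: cD; cont.
    + apply: (cosusl_all_polish pX); apply: (cosusl_all_polish pX).
      by apply: cosusl_imp; [apply: susl_codedA; cont|apply: cD; cont].
    + do 3!apply: (cosusl_all_polish pX).
      apply: cosusl_imp; first by apply: susl_codedA; cont.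
      by apply: cosusl_imp; [apply: susl_codedA; cont|apply: cD; cont].
  - apply: (@cosusl_finite R _ X (fun b x y => A (bcol n b) (x, y)) pX).
    by apply: susl_codedA; cont.
  - by apply: cosusl_BC; exact: cb.
  - apply: (cosusl_all_polish pXX).
    by apply: cosusl_imp; [apply: susl_codedA; cont|apply: cD; cont].
apply/seteqP; split => b /= wb n.
  have [hB [/(fberE _ pX)[_ [rA sA tA] fA] iA]] := wb n; have [hB' _] := wb n.+1.
  do !split => //.
  - by move=> x; apply/AD => //; exact: rA.
  - by move=> x y /sA /AD; exact.
  - by move=> x y z h1 h2; apply/AD => //; exact: tA h1 h2.
  - by move=> p /iA /AD; exact.
have [hB [[rA [sA tA]] [fA [hB' iA]]]] := wb n; split => //; split; last first.
  by move=> p /iA /AD; exact.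
apply/(fberE _ pX); split => //; first exact: (codedA_borel pXX hB).
split=> [x|x y|x y z] /=.
- exact/AD.
- by move=> /sA /AD; exact.
- by move=> h1 h2; apply/AD => //; exact: tA h1 h2.
Qed.

Lemma hyperfinite_wit (E : set XX) : hyperfinite (@borel X) E ->
  exists2 b, wit b & forall p, E p <-> exists n, A (bcol n b) p.
Proof.
move=> [F [fF [iF ->]]].
have /(_ _)/cid hc n : exists c, BC K XX c /\ [set p | A c p] = F n.
  have /(fberE _ pX)[bF _ _] := fF n.
  (* A single Borel set gets a code as the section of a product at an arbitrary parameter. *)
  have bF' : borel [set q : baire * XX | F n q.2].
    by apply: (@continuous_borel _ _ snd _ _ bF); cont.
  have [f _ hf] := codedA_sections K pXX (polish_baire R) bF'.
  by have [h1 h2] := hf (fun _ => 0); exists (f (fun _ => 0)); split => //; rewrite h2.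
pose b := bglue (fun n => projT1 (hc n)).
have hb n : BC K XX (bcol n b) /\ [set p | A (bcol n b) p] = F n.
  by rewrite /b bcol_bglue; case: (hc n).
have Ab n p : A (bcol n b) p <-> F n p by have [_ <-] := hb n.
exists b => [n|p].
  have [h1 h2] := hb n; rewrite h2; split => //; split; first exact: fF.
  by move=> p /Ab/iF/Ab.
by split=> [[n _ /Ab]|[n /Ab]]; exists n.
Qed.

Lemma wit_hyperfinite (E : set XX) b : wit b ->
  (forall p, E p <-> exists n, A (bcol n b) p) -> hyperfinite (@borel X) E.
Proof.
move=> wb hE; exists (fun n => [set p | A (bcol n b) p]); split.
  by move=> n; have [_ []] := wb n.
split; first by move=> n p; have [_ [_]] := wb n; exact.
by apply/seteqP; split=> p; [move=> /hE[n]; exists n|move=> [n _ h]; apply/hE; exists n].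
Qed.

Lemma hyperfinite_cber (E : set XX) : hyperfinite (@borel X) E -> cber (@borel X) E.
Proof.
move=> [F [fF [iF ->]]].
have iFle n m p : n <= m -> F n p -> F m p.
  by move=> /subnKC <-; elim: (m - n) => [|k IH]; rewrite ?addn0 // addnS => /IH/iF.
split; first split.
- by apply: sigma_algebra_bigcup => n; have [[]] := fF n.
- split=> [x|x y [n _ h]|x y z [n _ h] [m _ h']].
  + by exists 0 => //; have [[_ [r _ _]] _] := fF 0; exact: r.
  + by exists n => //; have [[_ [_ s _]] _] := fF n; exact: s.
  + exists (maxn n m) => //; have [[_ [_ _ t]] _] := fF (maxn n m).
    by apply: t (iFle _ _ _ (leq_maxl _ _) h) (iFle _ _ _ (leq_maxr _ _) h').
- move=> x; rewrite (_ : mkset _ = \bigcup_n [set y | F n (x, y)]).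
    apply: bigcup_countable => // n _; apply: finite_set_countable.
    by have [] := fF n.
  by apply/seteqP; split => y [n]; exists n.
Qed.

End witnesses.

(** * Trees of closed sets *)

Local Notation code := CodeSeq.code.
Local Notation decode := CodeSeq.decode.

(** Needed for the recursion on levels: deciding the sequence with code [i] only involves sequences
    of length at most [i]. *)
Lemma size_code s : size s <= code s.
Proof.
elim: s => //= n s IH; apply: leq_ltn_trans IH _.
rewrite -[X in X < _]mul1n; apply: (@leq_trans (1 * (code s).*2.+1)).
  by rewrite !mul1n ltnS -addnn leq_addr.
by rewrite leq_mul2r expn_gt0 orbT.
Qed.

Section trees.
Variable Q : set (baire * baire * baire).

(** For closed [Q] its branches are exactly the [u] with [Q ((a, b), u)], and membership of [s]
    depends only on the first [size s] values of [a] and [b]. *)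
Definition tree (a b : baire) : set (seq nat) := [set s | exists a' b' u,
  Q ((a', b'), u) /\ [/\ pre a' (size s) = pre a (size s),
    pre b' (size s) = pre b (size s) & pre u (size s) = s]].

Lemma tree_rcons a b s i : tree a b (rcons s i) -> tree a b s.
Proof.
move=> [a' [b' [u [Qu]]]]; rewrite size_rcons => -[ea eb eu].
exists a', b', u; split => //; split; [exact: pre_le ea|exact: pre_le eb|].
by move: eu; rewrite preS => /rcons_inj[].
Qed.

Lemma tree_local a b a' b' s : pre a (size s) = pre a' (size s) ->
  pre b (size s) = pre b' (size s) -> tree a b s -> tree a' b' s.
Proof.
by move=> ea eb [a1 [b1 [u [Qu [e1 e2 e3]]]]]; exists a1, b1, u; rewrite e1 e2 ea eb.
Qed.

Lemma tree_branch a b u : closed Q -> (forall n, tree a b (pre u n)) -> Q ((a, b), u).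
Proof.
move=> cQ hu; move: cQ; rewrite closedE; apply => -[[P3 P2]] /= [[[P1 P0]]] /=.
move=> [/nbhs_baire[n1 h1] /nbhs_baire[n2 h2]] hP /nbhs_baire[n3 h3] hQ.
pose n := maxn n1 (maxn n2 n3).
have [a' [b' [u' [Qu]]]] := hu n; rewrite size_pre => -[ea eb eu].
apply: (hQ ((a', b'), u')) => //; split => /=.
  apply: hP; split => /=; [apply: h1; apply: pre_le ea|apply: h2; apply: pre_le eb].
    exact: leq_maxl.
  exact: leq_trans (leq_maxl n2 n3) (leq_maxr _ _).
apply: h3; apply: pre_le eu.
exact: leq_trans (leq_maxr n2 n3) (leq_maxr _ _).
Qed.

Lemma branch_tree a b u n : Q ((a, b), u) -> tree a b (pre u n).
Proof. by move=> Qu; exists a, b, u; rewrite !size_pre. Qed.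

End trees.

(** * The diagonal construction *)

(* A real [v] codes a real [vev v] together with a length- and
   initial-segment-preserving map [vmap v] of finite sequences. *)
Definition vev : baire -> baire := reidx double.

Definition vmap (v : baire) (s : seq nat) : seq nat :=
  mkseq (fun k => v (code (take k.+1 s)).*2.+1) (size s).

Lemma vmap_rcons v s i : vmap v (rcons s i) = rcons (vmap v s) (v (code (rcons s i)).*2.+1).
Proof.
rewrite /vmap size_rcons mkseqS take_oversize ?size_rcons //; congr rcons.
apply/eq_in_map => k; rewrite mem_iota add0n => /andP[_ ltk].
by rewrite -cats1 takel_cat.
Qed.

(** The first [n] values of [v] then determine [vmap v s] and the first [size s] values of
    [vev v]. *)
Definition visible (s : seq nat) n := forall k, k <= size s -> (code (take k s)).*2.+1 < n.

Lemma visible_size s n : visible s n -> size s < n.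
Proof.
move=> /(_ _ (leqnn _)); rewrite take_size => h; apply: leq_ltn_trans (size_code s) _.
by apply: leq_ltn_trans h; apply: leqW; rewrite -addnn leq_addr.
Qed.

Lemma visible_ex s : exists n, visible s n.
Proof.
exists (\max_(k < (size s).+1) (code (take k s)).*2.+1).+1 => k lek.
rewrite ltnS; apply: (@leq_bigmax _ (fun k : 'I_(size s).+1 => (code (take k s)).*2.+1) (Ordinal _)).
by rewrite ltnS.
Qed.

Lemma vmap_local v v' s n : visible s n -> pre v n = pre v' n -> vmap v s = vmap v' s.
Proof.
move=> vs /preP e; apply/eq_in_map => k; rewrite mem_iota add0n => /andP[_ ltk].
by apply: e; exact: vs.
Qed.

Lemma vev_local v v' s n : visible s n -> pre v n = pre v' n ->
  pre (vev v) (size s) = pre (vev v') (size s).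
Proof.
move=> vs /preP e; apply/preP => i lti; apply: e.
have := vs _ (leqnn _); rewrite take_size => h; apply: leq_ltn_trans h.
by apply: leqW; rewrite leq_double; apply: leq_trans (ltnW lti) (size_code s).
Qed.

Section search_tree.
Variables (Q Q' : set (baire * baire * baire)).

(* [search p t]: finite attempts at a real [w'] and a map of [tree Q p w'] into [t]. *)
Definition search (p : baire) (t : set (seq nat)) : set (seq nat) := [set s |
  forall r, visible r (size s) -> tree Q p (vev (nth 0 s)) r -> t (vmap (nth 0 s) r)].

Lemma search_rcons p t s i : search p t (rcons s i) -> search p t s.
Proof.
move=> h r vr; have e : pre (nth 0 s) (size s) = pre (nth 0 (rcons s i)) (size s).
  by apply/preP => k ltk; rewrite nth_rcons ltk.
have vr' : visible r (size (rcons s i)) by move=> k /vr; rewrite size_rcons => /leqW.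
rewrite (vmap_local vr e) => tr; apply: h => //.
exact: tree_local (vev_local vr e) tr.
Qed.

(** A branch of the search tree is a total map, because every node becomes visible at some
    length. *)
Lemma searchP p t v : (forall n, search p t (pre v n)) <->
  (forall r, tree Q p (vev v) r -> t (vmap v r)).
Proof.
have e n : pre (nth 0 (pre v n)) n = pre v n.
  by have := pre_nth (pre v n); rewrite size_pre.
split=> [h r|h n r]; last first.
  rewrite size_pre => vr; rewrite (vmap_local vr (e n)) => tr; apply: h.
  exact: tree_local (vev_local vr (e n)) tr.
have [n vr] := visible_ex r; rewrite -(vmap_local vr (e n)) => tr; apply: (h n) => //.
  by rewrite size_pre.
exact: tree_local (esym (vev_local vr (e n))) tr.
Qed.

Definition of_tree (z : baire) : set (seq nat) := [set s | z (code s) = 1].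

Definition zstep (p w z : baire) : baire :=
  fun i => nat_of_bool `[< search p (tree Q' w z) (decode i) >].

(** Value [i] concerns a sequence of length at most [i]. The nodes visible to it and their images
    are no longer, and by [tree_local] they read only the first [i] values of [p], [w] and [z]. *)
Lemma zstep_local p w z p' w' z' i : pre p i = pre p' i -> pre w i = pre w' i ->
  pre z i = pre z' i -> zstep p w z i = zstep p' w' z' i.
Proof.
have aux p1 w1 z1 p2 w2 z2 : pre p1 i = pre p2 i -> pre w1 i = pre w2 i ->
    pre z1 i = pre z2 i -> search p1 (tree Q' w1 z1) (decode i) ->
    search p2 (tree Q' w2 z2) (decode i).
  move=> ep ew ez h r vr tr.
  have lr : size r <= i.
    by rewrite -(CodeSeq.decodeK i); apply: leq_trans (size_code _); exact/ltnW/visible_size.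
  have lv : size (vmap (nth 0 (decode i)) r) <= i by rewrite size_mkseq.
  apply: tree_local (pre_le lv ew) (pre_le lv ez) _; apply: h => //.
  exact: tree_local (pre_le lr (esym ep)) _ tr.
move=> ep ew ez; congr nat_of_bool; apply/asboolP/asboolP; exact: aux.
Qed.

(** Value [i] is stable from iterate [i.+1] on, so the diagonal of the iterates is a fixed point. *)
Definition zfix (p w : baire) : baire := fun i => iter i.+1 (zstep p w) (fun _ => 0) i.

Lemma zfixE p w : zfix p w = zstep p w (zfix p w).
Proof.
suff h i : forall m, i < m -> iter m (zstep p w) (fun _ => 0) i = zstep p w (zfix p w) i.
  by apply/funext => i; exact: h.
elim/ltn_ind: i => i IH [//|m]; rewrite ltnS => leim; rewrite iterS.
apply: zstep_local => //; apply/preP => j ltji.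
by rewrite (IH j ltji m (leq_trans ltji leim)) /zfix (IH j ltji j.+1).
Qed.

Lemma zfix_local p w p' w' i : pre p i = pre p' i -> pre w i = pre w' i ->
  zfix p w i = zfix p' w' i.
Proof.
elim/ltn_ind: i => i IH ep ew; rewrite zfixE [in RHS]zfixE.
apply: zstep_local => //; apply/preP => j ltji.
by apply: IH => //; [exact: pre_le (ltnW ltji) ep|exact: pre_le (ltnW ltji) ew].
Qed.

Lemma zfix_continuous : continuous (fun pw : baire * baire => zfix pw.1 pw.2).
Proof.
apply: continuous_to_baire => i [p w] /=.
exists ([set p' | pre p' i = pre p i], [set w' | pre w' i = pre w i]) => /=.
  by split; apply/nbhs_baire; exists i.
by move=> [p' w'] /= [ep ew]; exact: zfix_local.
Qed.

Lemma of_tree_zfix p w s : of_tree (zfix p w) s <-> search p (tree Q' w (zfix p w)) s.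
Proof.
rewrite /of_tree /= {1}zfixE /zstep CodeSeq.codeK.
by split; case: asboolP.
Qed.

End search_tree.

(** [stuck T t r s]: no map of the subtree of [T] above [r] into the subtree of
    [t] above [s] exists. *)
Inductive stuck (T t : set (seq nat)) : seq nat -> seq nat -> Prop :=
| stuck_out r s : ~ t s -> stuck T t r s
| stuck_step r s i : T (rcons r i) -> (forall j, stuck T t (rcons r i) (rcons s j)) ->
    stuck T t r s.

Lemma stuckE T t r s : stuck T t r s <->
  (~ t s \/ exists i, T (rcons r i) /\ forall j, stuck T t (rcons r i) (rcons s j)).
Proof.
split; first by case=> [r' s' h|r' s' i h1 h2]; [left|right; exists i].
by move=> [|[i [h1 h2]]]; [exact: stuck_out|exact: stuck_step h1 h2].
Qed.

(** A branch [u] of [t] could receive every node of [T] at the prefix of [u] of the same length, so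
    following [u] never gets stuck. *)
Lemma stuck_wf T t r u : stuck T t r [::] -> ~ forall n, t (pre u n).
Proof.
move=> st tu; have : forall r s, stuck T t r s -> s = pre u (size s) -> False.
  move=> {r st} r s; elim=> [{}r {}s nt e|{}r {}s i _ _ IH e].
    by apply: nt; rewrite e.
  by apply: (IH (u (size s))); rewrite size_rcons preS -e.
by move=> /(_ _ _ st); exact.
Qed.

Lemma bar_induction (T : set (seq nat)) (Pr : seq nat -> Prop) :
  (forall s i, T (rcons s i) -> T s) -> ~ (exists u, forall n, T (pre u n)) ->
  (forall s, (forall i, T (rcons s i) -> Pr (rcons s i)) -> Pr s) -> forall s, Pr s.
Proof.
move=> tT wT hP s0; apply: contrapT => nP; apply: wT.
(* The starting node [s0] may lie outside [T], but all later nodes of the branch lie in it. *)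
have [|s [ns _]|u hu] := @branch_extend (fun s => ~ Pr s /\ (s = s0 \/ T s)) s0.
- by split => //; left.
- apply: contrapT => h; apply: ns; apply: hP => i Ti.
  by apply: contrapT => nPi; apply: h; exists i; split => //; right.
exists u => n; have [s [_ sT] [les es]] := hu (maxn n (size s0).+1).
rewrite -(take_pre u (leq_maxl n (size s0).+1)) -es take_takel ?leq_maxl //.
case: sT => [e|Ts]; last exact: closed_take.
by move: les; rewrite geq_max e ltnn andbF.
Qed.

(** * Greedy maps between trees *)

Section greedy_map.
Variables T t : set (seq nat).

(* Histories are reversed, as in [Happ]. *)
Fixpoint greedy (r : seq nat) : seq nat :=
  if r is i :: r' then
    rcons (greedy r') (least (fun j => ~ stuck T t (rev (i :: r')) (rcons (greedy r') j)))
  else [::].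

(** If a node is not stuck, each of its children in [T] has an image that is not stuck either;
    taking the least such image preserves this along [T]. *)
Lemma greedy_ok : (forall s i, T (rcons s i) -> T s) -> ~ stuck T t [::] [::] ->
  forall s, T s -> t (greedy (rev s)).
Proof.
move=> tT n0 s Ts; suff : ~ stuck T t s (greedy (rev s)).
  by move=> h; apply: contrapT => h'; apply: h; exact: stuck_out.
elim/last_ind: s Ts => [//|s i IH] Ts; rewrite rev_rcons /= -rev_rcons revK.
have /IH ns := tT _ _ Ts.
have [j nj] : exists j, ~ stuck T t (rcons s i) (rcons (greedy (rev s)) j).
  apply: contrapT => h; apply: ns; apply: stuck_step Ts _ => j.
  by apply: contrapT => h'; apply: h; exists j.
exact: (@least_ex (fun j => ~ stuck T t (rcons s i) (rcons (greedy (rev s)) j)) j nj).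
Qed.

(** Packs [w] and the greedy map into the format read by [vev] and [vmap], for which the last entry
    of each image suffices. *)
Definition greedy_branch (w : baire) : baire := fun i =>
  if odd i then last 0 (greedy (rev (decode i./2))) else w i./2.

Lemma vev_greedy w : vev (greedy_branch w) = w.
Proof. by apply/funext => i; rewrite /vev /reidx /greedy_branch odd_double doubleK. Qed.

Lemma vmap_greedy w s : vmap (greedy_branch w) s = greedy (rev s).
Proof.
elim/last_ind: s => [//|s i IH]; rewrite vmap_rcons IH {1}/greedy_branch /= odd_double /=.
by rewrite uphalf_double CodeSeq.codeK rev_rcons /= last_rcons.
Qed.

End greedy_map.

Section diagonal.
Variables (R : realType) (K : borel_coding R).
Variable F : nat -> nat -> set (baire * baire).
Hypothesis fF : forall n m, fber (@borel baire) (F n m).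
Hypothesis Fm : forall n m, F n m `<=` F n m.+1.
Hypothesis FS : forall n m p, F n m p -> exists m', F n.+1 m' p.
Hypothesis nE : ~ hyperfinite (@borel baire) (Eall F).

Local Notation X := (baire * baire)%type.
Local Notation pb := (polish_baire R).
Local Notation A c p := (@codedA R K (X * X)%type (c, p)).

Let pX : polish R X. Proof. exact: polish_prod pb pb. Qed.
Let pXX : polish R (X * X)%type. Proof. exact: polish_prod pX pX. Qed.

Lemma borel_Xdom : borel [set zx : X | Xdom F (of_tree zx.1) zx.2].
Proof.
apply: borel_all => t; apply: borel_ex => n; apply: borel_and; first exact: borel_cst.
apply: borel_all => s; do 2![apply: borel_imp; first exact: borel_cst].
apply: borel_imp.
  apply: (@borel_map_coord _ fst (CodeSeq.code s) [set 1]).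
  by apply: continuous_borel; cont.
apply: borel_ex => k; apply: borel_and; first exact: borel_cst.
apply: (@continuous_borel _ _ snd _ _ (borel_good R fF (rev (take k s)) (nth 0 s k))); cont.
Qed.

Lemma borel_Eall : borel (Eall F).
Proof. by apply: borel_ex => n; apply: borel_ex => m; exact: (borel_F R fF). Qed.

Definition live (z x y : baire) :=
  (Xdom F (of_tree z) x /\ Xdom F (of_tree z) y) /\ Eall F (x, y).

Lemma borel_live (T : topologicalType) (z x y : T -> baire) : continuous z ->
  continuous x -> continuous y -> borel [set t | live (z t) (x t) (y t)].
Proof.
move=> cz cx cy; apply: borel_and; first apply: borel_and.
- by apply: (@continuous_borel _ _ (fun t => (z t, x t)) _ _ borel_Xdom); cont.
- by apply: (@continuous_borel _ _ (fun t => (z t, y t)) _ _ borel_Xdom); cont.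
- by apply: (@continuous_borel _ _ (fun t => (x t, y t)) _ _ borel_Eall); cont.
Qed.

(** Only one inclusion is demanded, and only in the fibre over [w] itself; a witness that relates
    too much is later intersected with [Esec]. *)
Definition correct (w z : baire) := wit K X w /\
  forall x y, live z x y -> exists n, A (bcol n w) ((w, x), (w, y)).

Lemma cosusl_correct : cosusl [set wz : X | correct wz.1 wz.2].
Proof.
have [D [AD cD]] := cosusl_codedA K pX.
rewrite (_ : mkset _ = [set wz : X | wit K X wz.1 /\
  forall x y, live wz.2 x y -> exists n, D (bcol n wz.1, ((wz.1, x), (wz.1, y)))]).
  apply: cosusl_and.
    by apply: (@cosusl_preim _ _ fst _ _ (cosusl_wit K pX)); cont.
  do 2!apply: (cosusl_all_polish pb).
  apply: cosusl_imp.
    by apply: (@borel_susl R); [exact: polish_prod (polish_prod pX pb) pb|apply: borel_live; cont].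
  by apply: cosusl_ex => n; apply: cD; rewrite /bcol; cont.
apply/seteqP; split => -[w z] /= [ww h]; split => // x y /h[n An]; exists n;
  by apply/AD => //; have [] := ww n.
Qed.

Section fixed_trees.
Variables Q Q' : set (baire * baire * baire).
Hypothesis cQ : closed Q.
Hypothesis cQ' : closed Q'.
Hypothesis Q'P : forall w z, (~ correct w z) <-> exists u, Q' ((w, z), u).

Local Notation zf := (zfix Q Q').

Definition Ediag : set (baire * (X * X)) := [set q | q.2.1.1 = q.2.2.1 /\
  (q.2.1.2 = q.2.2.2 \/ live (zf q.1 q.2.1.1) q.2.1.2 q.2.2.2)].

Definition Esec (p : baire) : set (X * X) := [set r | Ediag (p, r)].

Lemma borel_Ediag : borel Ediag.
Proof.
apply: borel_and; last apply: borel_or.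
- by apply: borel_closed; apply: closed_eq_fun hausdorff_baire _ _; cont.
- by apply: borel_closed; apply: closed_eq_fun hausdorff_baire _ _; cont.
- have cz := @zfix_continuous Q Q'.
  apply: borel_live; [|cont|cont].
  by apply: (@cont_comp _ _ _ (fun pw => zf pw.1 pw.2) (fun q : baire * (X * X) => (q.1, q.2.1.1)) cz); cont.
Qed.

Lemma live_equiv z : Equivalence (fun x y => x = y \/ live z x y).
Proof.
have [rE sE tE] := Eall_equiv fF Fm FS.
split=> [x|x y|x y z']; first by left.
  by move=> [->|[[h1 h2] h3]]; [left|right; split => //; exact: sE].
move=> [->//|[[h1 h2] h3]] [<-|[[h4 h5] h6]]; first by right.
by right; split => //; exact: tE h3 h6.
Qed.

(** A branch of [z] would map some tree [tree Q p w'] into the tree of refutations. The former has a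
    branch, whose image would refute that [w] is correct. *)
Lemma zf_wf p w : (forall w', exists u, Q ((p, w'), u)) -> correct w (zf p w) ->
  forall x, Xdom F (of_tree (zf p w)) x.
Proof.
move=> hQ cw x; apply: (Xdom_wf R fF Fm FS).
  by move=> s i /of_tree_zfix h; apply/of_tree_zfix; exact: search_rcons h.
move=> [v hv].
have /searchP h : forall n, search Q p (tree Q' w (zf p w)) (pre v n).
  by move=> n; apply/of_tree_zfix; exact: hv.
have [u Qu] := hQ (vev v).
suff : exists u', Q' ((w, zf p w), u') by move=> /Q'P; exact.
(* The image of the branch [u] under [vmap v], read off entry by entry. *)
exists (fun k => v (CodeSeq.code (pre u k.+1)).*2.+1); apply: (tree_branch cQ') => n.
rewrite (_ : pre _ n = vmap v (pre u n)).
  by apply: h; exact: branch_tree.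
rewrite /vmap size_pre; apply/eq_in_map => k; rewrite mem_iota add0n => /andP[_ ltk].
by rewrite take_pre.
Qed.

(** The diagonal argument: a witness [w] for [Esec p] is correct in its own fibre, so by [zf_wf]
    that fibre carries the whole of [Eall F], and restricting [w] to it makes [Eall F]
    hyperfinite. *)
Lemma Esec_not_hyperfinite p : (forall w', exists u, Q ((p, w'), u)) ->
  ~ hyperfinite (@borel X) (Esec p).
Proof.
move=> hQ /(hyperfinite_wit K pX)[w ww hw].
have cw : correct w (zf p w).
  by split => // x y lxy; apply/hw; split => //=; right.
have Xall := zf_wf hQ cw.
apply: nE; exists (fun n => [set r | A (bcol n w) ((w, r.1), (w, r.2))]); split.
  move=> n; have [_ [/(fberE _ pX)[bA [rA sA tA] fA] _]] := ww n.
  apply/(fberE _ pb); split.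
  - by apply: (@continuous_borel _ _ (fun r : X => ((w, r.1), (w, r.2))) _ _ bA); cont.
  - by split=> [x|x y|x y z] /=; [exact: rA|exact: sA|exact: tA].
  - move=> x; rewrite (_ : mkset _ = (fun y => (w, y)) @^-1` [set r | A (bcol n w) ((w, x), r)]) //.
    by apply: finite_preimage; [move=> a b _ _ []|exact: fA].
split; first by move=> n r /=; have [_ [_]] := ww n; apply.
apply/seteqP; split => -[x y] /=.
  move=> Exy; have /hw[n h] : Esec p ((w, x), (w, y)) by split => //; right.
  by exists n.
move=> [n _ /= h]; have [_ /= [->|[]]] := (hw ((w, x), (w, y))).2 (ex_intro _ n h) => //.
by have [r _ _] := Eall_equiv fF Fm FS; exact: r.
Qed.

(** Stuckness unfolds along the well-founded tree of [(p, w0)], which does not change with [w], so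
    bar induction gives a Borel set. *)
Lemma borel_stuck p w0 : (forall u, ~ Q ((p, w0), u)) -> forall r s,
  borel [set w | stuck (tree Q p w0) (tree Q' w (zf p w)) r s].
Proof.
move=> nQ; apply: (@bar_induction (tree Q p w0)).
- by move=> s i; exact: tree_rcons.
- by move=> [u hu]; exact: (nQ u (tree_branch cQ hu)).
move=> r IH s; rewrite (_ : mkset _ = [set w | ~ tree Q' w (zf p w) s \/
    exists i, tree Q p w0 (rcons r i) /\ forall j,
      stuck (tree Q p w0) (tree Q' w (zf p w)) (rcons r i) (rcons s j)]).
  apply: borel_or.
    apply: borel_not; apply: borel_open; rewrite openE => w /= h.
    apply/nbhs_baire; exists (size s) => w' ew; apply: tree_local h => //.
    by apply/preP => i lti; apply: zfix_local => //; exact: pre_le (ltnW lti) (esym ew).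
  apply: borel_ex => i; have [Ti|nTi] := pselect (tree Q p w0 (rcons r i)).
    apply: borel_and; first exact: borel_cst.
    by apply: borel_all => j; exact: IH.
  rewrite (_ : mkset _ = [set _ | False]); first exact: borel_cst.
  by apply/seteqP; split => w // [].
by apply/seteqP; split => w /= /stuckE.
Qed.

Lemma Esec_hyperfinite p w0 : (forall u, ~ Q ((p, w0), u)) ->
  hyperfinite (@borel X) (Esec p).
Proof.
move=> nQ; have bS := borel_stuck nQ.
(* The Borel case distinction: where [st] holds, no refutation exists and [w] is correct; elsewhere
   the greedy map gives a branch [v w] of [z]. *)
pose st w := stuck (tree Q p w0) (tree Q' w (zf p w)) [::] [::].
pose v w := greedy_branch (tree Q p w0) (tree Q' w (zf p w)) w0.
have bv : borel_map v.
  pose gr r w := greedy (tree Q p w0) (tree Q' w (zf p w)) r.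
  have bg r s : borel [set w | gr r w = s].
    elim: r s => [|i r IH] s; first exact: (@borel_cst baire ([::] = s)).
    rewrite (_ : mkset _ = [set w | exists s', gr r w = s' /\ exists j,
      least (fun j => ~ stuck (tree Q p w0) (tree Q' w (zf p w)) (rev (i :: r)) (rcons s' j)) = j /\
      rcons s' j = s]).
      apply: borel_ex => s'; apply: borel_and; first exact: IH.
      apply: borel_ex => j; apply: borel_and; last exact: borel_cst.
      apply: (@borel_least _ (fun j w =>
        ~ stuck (tree Q p w0) (tree Q' w (zf p w)) (rev (i :: r)) (rcons s' j))) => k.
      by apply: borel_not; exact: bS.
    apply/seteqP; split => w /=; last by move=> [s' [<- [j [<- <-]]]].
    by move=> <-; exists (gr r w); split => //; eexists; split.
  apply: borel_map_baire => i j; rewrite /v /greedy_branch; case: (odd i); last exact: borel_cst.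
  rewrite (_ : mkset _ = [set w | exists s, gr (rev (CodeSeq.decode i./2)) w = s /\ last 0 s = j]).
    by apply: borel_ex => s; apply: borel_and; [exact: bg|exact: borel_cst].
  by apply/seteqP; split => w /=; [exists (gr (rev (CodeSeq.decode i./2)) w)|move=> [s [<-]]].
have vbr w : ~ st w -> forall n, of_tree (zf p w) (pre (v w) n).
  move=> nst n; apply/of_tree_zfix; move: n; apply/searchP => r.
  rewrite vev_greedy vmap_greedy; apply: greedy_ok => //.
  by move=> s i; exact: tree_rcons.
have corr w : st w -> correct w (zf p w).
  move=> sw; apply: contrapT => /Q'P[u Qu]; apply: (stuck_wf sw (u := u)) => n.
  exact: branch_tree.
(* In the fibre over [w] the approximation follows the witness [w] if [st w] holds, and the history
   along [v w] otherwise. *)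
pose M n : set (X * X) := [set r |
  (~ st r.1.1 -> Happ F (rev (pre (v r.1.1) n)) (r.1.2, r.2.2)) /\
  (st r.1.1 -> A (bcol n r.1.1) ((r.1.1, r.1.2), (r.1.1, r.2.2)))].
have bst (T : topologicalType) (f : T -> baire) : continuous f -> borel [set t | st (f t)].
  by move=> cf; exact: (continuous_borel cf (bS [::] [::])).
have bM n : borel (M n).
  apply: borel_and.
    apply: borel_imp; first by apply: borel_not; apply: bst; cont.
    rewrite (_ : mkset _ = [set r : X * X | exists s, pre (v r.1.1) n = s /\ Happ F (rev s) (r.1.2, r.2.2)]).
      apply: borel_ex => s; apply: borel_and.
        have bs : borel [set u : baire | pre u n = s].
          by apply: borel_open; apply: (@open_pre _ (fun u => u) n [set s]); cont.
        have bs' := bv _ bs.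
        by apply: (@continuous_borel _ _ (fun r : X * X => r.1.1) _ _ bs'); cont.
      apply: (@continuous_borel _ _ (fun r : X * X => (r.1.2, r.2.2)) _ _ (borel_Happ R fF (rev s))).
      by cont.
    by apply/seteqP; split=> r /=; [exists (pre (v r.1.1) n)|move=> [s [<-]]].
  rewrite (_ : mkset _ = [set r : X * X | ~ st r.1.1 \/
      (st r.1.1 /\ A (bcol n r.1.1) ((r.1.1, r.1.2), (r.1.1, r.2.2)))]); last first.
    apply/seteqP; split => r /=; last by move=> [h|[h1 h2]].
    by move=> h; have [s|s] := pselect (st r.1.1); [right; split => //; exact: h|left].
  apply: borel_or; first by apply: borel_not; apply: bst; cont.
  have bs1 : borel [set r : X * X | st r.1.1] by apply: bst; cont.
  (* Where [st] holds the columns are codes, so membership has both an analytic and a coanalytic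
     form. *)
  apply: (suslin pXX).
    apply: susl_and; first exact: (borel_susl pXX).
    by apply: (susl_codedA K pX); rewrite /bcol; cont.
  have [D [AD cD]] := cosusl_codedA K pX.
  rewrite (_ : mkset _ = [set r : X * X | st r.1.1 /\
      D (bcol n r.1.1, ((r.1.1, r.1.2), (r.1.1, r.2.2)))]).
    apply: cosusl_and; first exact: (borel_cosusl pXX).
    by apply: cD; rewrite /bcol; cont.
  by apply/seteqP; split => r /= [sr h]; split => //; apply/AD => //;
    have [/(_ n)[]] := corr _ sr.
exists (fun n => [set r | Esec p r /\ M n r]); split.
  move=> n; apply/(fberE _ pX); split.
  - apply: borel_and; last exact: bM.
    by apply: (@continuous_borel _ _ (fun r => (p, r)) _ _ borel_Ediag); cont.
  - split=> [[w x]|[w x] [w' y]|[w x] [w' y] [w'' z]] /=.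
    + split; first by split => //; left.
      split=> /= sw; first by have [[_ [r _ _]] _] := Happ_fber R fF (rev (pre (v w) n)); exact: r.
      by have [ww _] := corr w sw; have [_ [[[_ [r _ _]] _] _]] := ww n; exact: r.
    + rewrite /M /= => -[[/= e1 e2] [h1 h2]]; subst w'; split; last split => sw.
      * by split => //=; have [_ s _] := live_equiv (zf p w); exact: s.
      * by have [[_ [_ s _]] _] := Happ_fber R fF (rev (pre (v w) n)); apply: s; exact: h1.
      * have [ww _] := corr w sw; have [_ [[[_ [_ s _]] _] _]] := ww n.
        by apply: s; exact: h2.
    + rewrite /M /= => -[[/= e1 e2] [h1 h2]]; subst w'.
      move=> [[/= e1 e2'] [h1' h2']]; subst w''; split; last split => sw.
      * by split => //=; have [_ _ t] := live_equiv (zf p w); exact: t e2 e2'.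
      * have [[_ [_ _ t]] _] := Happ_fber R fF (rev (pre (v w) n)).
        by apply: t (h1 sw) (h1' sw).
      * have [ww _] := corr w sw; have [_ [[[_ [_ _ t]] _] _]] := ww n.
        by apply: t (h2 sw) (h2' sw).
  - move=> [w x]; have [sw|nsw] := pselect (st w).
      have [ww _] := corr w sw; have [_ [[_ fA] _]] := ww n.
      apply: sub_finite_set (fA (w, x)) => -[w' y] /= [[/= e _] [_ /= h]]; subst w'.
      exact: h.
    apply: (@sub_finite_set _ _ ((fun y => (w, y)) @` [set y | Happ F (rev (pre (v w) n)) (x, y)])).
      move=> [w' y] /= [[/= e _] [/= h _]]; subst w'.
      by exists y => //; exact: h.
    by apply: finite_image; exact: (finite_Happ R fF).
split.
  move=> n [[w x] [w' y]] /= [E [/= h1 h2]]; split => //; split => /= sw.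
    by rewrite preS rev_rcons; apply: Happ_mono; exact: h1.
  by have [ww _] := corr w sw; have [_ [_ h]] := ww n; apply: h; exact: h2.
apply/seteqP; split => [[[w x] [w' y]] E|r [n _ []] //].
have [/= e lxy] := E; subst w'.
have [sw|nsw] := pselect (st w).
  have [ww hw] := corr w sw.
  suff [n An] : exists n, A (bcol n w) ((w, x), (w, y)) by exists n => //; split.
  case: lxy => [->|/hw //]; exists 0.
  by have [_ [[[_ [r _ _]] _] _]] := ww 0; exact: r.
suff [n Hn] : exists n, Happ F (rev (pre (v w) n)) (x, y) by exists n => //; split.
case: lxy => [->|[[Xx _] Exy]].
  by exists 0; have [[_ [r _ _]] _] := Happ_fber R fF (rev (pre (v w) 0)); exact: r.
by apply: (good_Happ fF) Exy; exact: Xdom_branch (vbr w nsw) Xx.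
Qed.

End fixed_trees.

(** [Q] unfolds the complement of [C], so [tree Q p w] is well founded exactly when [C (p, w)]
    holds. *)
Lemma sigma12_reduces (C : set (baire * baire)) : cosusl C ->
  exists2 EE : set (baire * (X * X)), borel EE &
    forall p, hyperfinite (@borel X) [set r | EE (p, r)] <-> exists w, C (p, w).
Proof.
move=> [Q cQ eQ]; have [Q' cQ' eQ'] := cosusl_correct.
have QP p w : ~ C (p, w) <-> exists u, Q ((p, w), u).
  by rewrite -[~ C _]/((~` C) (p, w)) eQ.
have Q'P w z : ~ correct w z <-> exists u, Q' ((w, z), u).
  by rewrite -[~ correct _ _]/((~` [set wz : X | correct wz.1 wz.2]) (w, z)) eQ'.
exists (Ediag Q Q'); first exact: borel_Ediag.
move=> p; split=> [h|[w Cw]].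
  apply: contrapT => nC; apply: (Esec_not_hyperfinite cQ' Q'P _ h) => w.
  by apply/QP => Cw; apply: nC; exists w.
apply: (@Esec_hyperfinite _ _ cQ Q'P p w) => u Qu.
by have : ~ C (p, w) by apply/QP; exists u.
Qed.

End diagonal.

(** * From Borel to continuous reductions *)

(** The only connective says that none of countably many formulas holds. It generates all Borel sets
    and leaves forcing with a single inductive clause. *)
Inductive bcode := bleaf of nat & nat | bnode of nat -> bcode.

Fixpoint beval (b : bcode) (p : baire) : Prop :=
  match b with
  | bleaf i j => p i = j
  | bnode f => forall n, ~ beval (f n) p
  end.

Definition bnot b := bnode (fun _ => b).

Lemma beval_not b p : beval (bnot b) p <-> ~ beval b p.
Proof. by split=> [/(_ 0)|h n]. Qed.

Lemma beval_ex (P : nat -> set baire) :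
  (forall n, exists b, forall p, P n p <-> beval b p) ->
  exists b, forall p, (exists n, P n p) <-> beval b p.
Proof.
move=> /(_ _)/cid h; exists (bnot (bnode (fun n => projT1 (h n)))) => p.
have e n : P n p <-> beval (projT1 (h n)) p by case: (h n).
rewrite beval_not /=; split; first by move=> [n /e Pn] /(_ n).
by move=> ne; apply: contrapT => nP; apply: ne => n /e Pn; apply: nP; exists n.
Qed.

Lemma borel_beval (A : set baire) : borel A -> exists b, forall p, A p <-> beval b p.
Proof.
have bC (P : set baire) : (exists b, forall p, P p <-> beval b p) ->
    exists b, forall p, ~ P p <-> beval b p.
  by move=> [b hb]; exists (bnot b) => p; rewrite beval_not hb.
have bT (P : Prop) : exists b, forall p, P <-> beval b p.
  have [b hb] : exists b, forall p, False <-> beval b p.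
    (* A contradiction: neither [p 0 = 0] nor its negation holds. *)
    exists (bnode (fun n => if n is 0 then bleaf 0 0 else bnot (bleaf 0 0))) => p; split => //.
    by move=> /= h; apply: (h 1) => n /=; exact: (h 0).
  have [hP|nP] := pselect P.
    by exists (bnot b) => p; rewrite beval_not -hb; split => // _ [].
  by exists b => p; rewrite -hb; split.
move: A; apply: borel_ind => [A oA|A|A hA].
- have [b hb] : exists b, forall p, (exists n, [set p | pre p (size (decode n)) = decode n /\
      [set q | pre q (size (decode n)) = decode n] `<=` A] p) <-> beval b p.
    apply: beval_ex => n; have [sub|nsub] := pselect ([set q | pre q (size (decode n)) = decode n] `<=` A);
      last by have [b hb] := bT False; exists b => p; rewrite -hb; split=> // -[].
    have [b hb] : exists b, forall p, ~ (exists i, [set p : baire |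
        i < size (decode n) /\ p i <> nth 0 (decode n) i] p) <-> beval b p.
      apply: (bC (fun p => exists i, _)); apply: beval_ex => i.
      have [lti|nlti] := pselect (i < size (decode n)); last first.
        by have [b hb] := bT False; exists b => p; rewrite -hb; split=> // -[].
      exists (bnot (bleaf i (nth 0 (decode n) i))) => p; rewrite beval_not /=.
      by split=> [[]|].
    exists b => p; rewrite -hb /=; split.
      by move=> [e _] [i [lti]]; apply; move: e; rewrite -[X in _ = X -> _]pre_nth => /preP; exact.
    move=> h; split => //; rewrite -[RHS]pre_nth; apply/preP => i lti.
    by apply: contrapT => ne; apply: h; exists i.
  exists b => p; rewrite -hb; split; last by move=> [n [e]]; exact.
  move=> Ap; move: oA; rewrite openE => /(_ p Ap)/nbhs_baire[n nA].
  by exists (code (pre p n)); rewrite /= CodeSeq.codeK size_pre; split => // q; exact: nA.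
- exact: bC.
- have [b hb] := beval_ex hA; exists b => p; rewrite -hb.
  by split=> [[n]|[n]]; exists n.
Qed.

(* A point of the parameter space is a pair of a code [c] (even coordinates) and
   a real [x] (odd coordinates). *)
Definition mkpair (c x : baire) : baire := fun i => if odd i then x i./2 else c i./2.
Definition podd : baire -> baire := reidx (fun k => k.*2.+1).

Lemma vev_mkpair c x : vev (mkpair c x) = c.
Proof. by apply/funext => i; rewrite /vev /reidx /mkpair odd_double doubleK. Qed.

Lemma podd_mkpair c x : podd (mkpair c x) = x.
Proof. by apply/funext => i; rewrite /podd /reidx /mkpair /= odd_double /= uphalf_double. Qed.

(** * Forcing for Borel codes and its labellings *)

Definition fleaf (c : baire) i j (s : seq nat) : Prop :=
  if odd i then i./2 < size s /\ nth 0 s i./2 = j else c i./2 = j.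

(** Cohen forcing for the real in the odd coordinates, with finite sequences as conditions. The even
    coordinates are read off the fixed real [c], so every condition decides them. *)
Fixpoint force (b : bcode) (c : baire) (s : seq nat) : Prop :=
  match b with
  | bleaf i j => fleaf c i j s
  | bnode f => forall n t, prefix s t -> ~ force (f n) c t
  end.

Lemma force_mono b c s t : prefix s t -> force b c s -> force b c t.
Proof.
case: b => [i j|f] /= st.
  rewrite /fleaf; case: ifP => // _ [lt e].
  move/prefixP: st => [r ->]; rewrite size_cat nth_cat lt.
  by rewrite (leq_trans lt) // leq_addr.
by move=> h n r tr; apply: h; exact: prefix_trans tr.
Qed.

(** Subformulas are addressed by finite sequences; an address that runs past a leaf stays at that
    leaf. *)
Fixpoint bsub (b : bcode) (s : seq nat) : bcode :=
  match s, b with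
  | n :: s', bnode f => bsub (f n) s'
  | _, _ => b
  end.

Lemma bsub_nil b : bsub b [::] = b.
Proof. by case: b. Qed.

Lemma bsub_rcons b s n :
  bsub b (rcons s n) = if bsub b s is bnode f then f n else bsub b s.
Proof.
elim: s b => [|m s IH] [i j|f] //=; first by case: (f n).
Qed.

(** The value 0 marks inner nodes, hence the shift by one at leaves. *)
Definition benc (b : bcode) : baire := fun a =>
  match bsub b (decode a) with
  | bleaf i j => (pickle (i, j)).+1
  | bnode _ => 0
  end.

Definition lab (l : baire) (s t : seq nat) : Prop := l (pickle (s, t)) = 1.

(** The recursion equations of forcing, required at every address. Being local they form a Borel
    condition, although the forcing relation itself is defined by recursion on a well-founded
    code. *)
Definition labelling (c l : baire) := forall s t,
  (c (code s) = 0 -> (lab l s t <-> forall n r, prefix t r -> ~ lab l (rcons s n) r)) /\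
  (forall i j, c (code s) = (pickle (i, j)).+1 -> (lab l s t <-> fleaf c i j t)).

Definition force_lab b (s t : seq nat) : Prop := force (bsub b s) (benc b) t.

Lemma benc_leaf b s i j : bsub b s = bleaf i j -> benc b (code s) = (pickle (i, j)).+1.
Proof. by move=> e; rewrite /benc CodeSeq.codeK e. Qed.

Lemma benc_node b s f : bsub b s = bnode f -> benc b (code s) = 0.
Proof. by move=> e; rewrite /benc CodeSeq.codeK e. Qed.

(** The code is well founded, so the equations determine the labels upwards from the leaves. *)
Lemma labelling_unique b l : labelling (benc b) l -> lab l = force_lab b.
Proof.
move=> hl; suff h b' : forall s, bsub b s = b' -> forall t, lab l s t <-> force_lab b s t.
  by apply/funext => s; apply/funext => t; apply/propext; exact: h.
elim: b' => [i j|f IH] s e t; rewrite /force_lab e /=.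
  by have [_ h] := hl s t; exact: h (benc_leaf e).
have [h _] := hl s t; rewrite (h (benc_node e)).
have e' n : bsub b (rcons s n) = f n by rewrite bsub_rcons e.
split=> h' n r tr fr; apply: (h' n r tr); have := IH n _ (e' n) r; rewrite /force_lab e'.
  by move=> ->.
by move=> <-.
Qed.

Lemma labelling_ex b : exists2 l, labelling (benc b) l & lab l = force_lab b.
Proof.
exists (fun a => if @unpickle (seq nat * seq nat)%type a is Some (s, t)
   then nat_of_bool `[< force_lab b s t >] else 0); last first.
  apply/funext => s; apply/funext => t; apply/propext; rewrite /lab pickleK.
  by case: asboolP; split.
set l : baire := fun a => _.
have labE s t : lab l s t <-> force_lab b s t.
  by rewrite /lab /l pickleK; case: asboolP; split.
move=> s t; split=> [|i j].
  case e : (bsub b s) => [i j|f]; first by rewrite (benc_leaf e).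
  move=> _; rewrite labE /force_lab e /=.
  have e' n : bsub b (rcons s n) = f n by rewrite bsub_rcons e.
  by split=> h n r tr; have := h n r tr; rewrite labE /force_lab e'.
case e : (bsub b s) => [i' j'|f]; last by rewrite (benc_node e).
rewrite (benc_leaf e) => -[] /(pcan_inj pickleK) [<- <-] {i j}.
by rewrite labE /force_lab e.
Qed.

(** * Generic reals for a labelling *)

Section generic.
Variable L : seq nat -> seq nat -> Prop.

(** The condition [t] decides the node at address [s]: it forces the node or refutes it by forcing a
    child. *)
Definition meets (s t : seq nat) := L s t \/ exists m, L (rcons s m) t.

Definition gstep (s t : seq nat) : seq nat := decode (least (fun a =>
  prefix t (decode a) /\ (meets s (decode a) \/ forall r, prefix t r -> ~ meets s r))).

Lemma gstepP s t : prefix t (gstep s t) /\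
  (meets s (gstep s t) \/ forall r, prefix t r -> ~ meets s r).
Proof.
suff [a ha] : exists a, prefix t (decode a) /\
    (meets s (decode a) \/ forall r, prefix t r -> ~ meets s r).
  exact: (@least_ex (fun a => prefix t (decode a) /\ _) a ha).
have [[r tr mr]|h] := pselect (exists2 r, prefix t r & meets s r).
  by exists (code r); rewrite CodeSeq.codeK; split => //; left.
exists (code t); rewrite CodeSeq.codeK; split; first exact: prefix_refl.
by right=> r tr mr; apply: h; exists r.
Qed.

(** Each stage first writes a digit of [a] and then tries to decide one address, so the limit is
    generic and still carries [a]. *)
Fixpoint gen (a : baire) n : seq nat :=
  if n is m.+1 then gstep (decode m) (rcons (gen a m) (a m)) else [::].

Lemma prefix_gen_rcons a n : prefix (rcons (gen a n) (a n)) (gen a n.+1).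
Proof. by have [] := gstepP (decode n) (rcons (gen a n) (a n)). Qed.

Lemma prefix_gen a m n : m <= n -> prefix (gen a m) (gen a n).
Proof.
move=> /subnKC <-; elim: (n - m) => [|k IH]; first by rewrite addn0 prefix_refl.
rewrite addnS; apply: prefix_trans IH _; apply: prefix_trans (prefix_gen_rcons a _).
exact: prefix_rcons.
Qed.

Lemma size_gen a n : n <= size (gen a n).
Proof.
elim: n => // n IH; have /prefixP[r ->] := prefix_gen_rcons a n.
by rewrite size_cat size_rcons addSn ltnS (leq_trans IH) // leq_addr.
Qed.

Definition phi (a : baire) : baire := fun i => nth 0 (gen a i.+1) i.

Lemma phi_nth a n i : i < size (gen a n) -> phi a i = nth 0 (gen a n) i.
Proof.
move=> lti; rewrite /phi; have [le|/ltnW le] := leqP n i.+1.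
  by have /prefixP[r ->] := prefix_gen a le; rewrite nth_cat lti.
by have /prefixP[r ->] := prefix_gen a le; rewrite nth_cat size_gen.
Qed.

Lemma pre_phi a n : pre (phi a) (size (gen a n)) = gen a n.
Proof. by rewrite -[RHS]pre_nth; apply/preP => i; exact: phi_nth. Qed.

Lemma gen_local a a' n : pre a n = pre a' n -> gen a n = gen a' n.
Proof.
elim: n => //= n IH e; rewrite IH; last exact: pre_le e.
by move/preP: e => ->.
Qed.

Lemma phi_local a a' n : pre a n = pre a' n -> pre (phi a) n = pre (phi a') n.
Proof.
move=> e; apply/preP => i lti; rewrite /phi (gen_local (a' := a')) //.
exact: pre_le e.
Qed.

(** The digit [a n] stands at position [size (gen a n)], and [gen a n] is determined by the earlier
    digits, so [a] is recovered inductively. *)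
Lemma phi_inj : injective phi.
Proof.
move=> a a' e; suff h : forall n, gen a n = gen a' n /\ a n = a' n.
  by apply/funext => n; have [] := h n.
have key b n : phi b (size (gen b n)) = b n.
  have /prefixP[r er] := prefix_gen_rcons b n.
  rewrite (@phi_nth b n.+1) er; last by rewrite size_cat size_rcons leq_addr.
  by rewrite nth_cat size_rcons ltnSn nth_rcons ltnn eqxx.
have ge n : gen a n = gen a' n -> a n = a' n by move=> eg; rewrite -(key a) -(key a') e eg.
elim=> [|n [IH1 IH2]]; first by split => //; exact: ge.
suff eg : gen a n.+1 = gen a' n.+1 by split => //; exact: ge.
by rewrite /= IH1 IH2.
Qed.

End generic.

(** The truth lemma, by induction on the subformula. A node that is true was decided at stage
    [code s]; it was not refuted there, by the induction hypothesis. *)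
Lemma truth b a s : beval (bsub b s) (mkpair (benc b) (phi (force_lab b) a)) <->
  exists k, force (bsub b s) (benc b) (pre (phi (force_lab b) a) k).
Proof.
set x := phi _ a; set c := benc b.
have prex k l : k <= l -> prefix (pre x k) (pre x l).
  by move=> le; rewrite -(take_pre x le); exact: prefix_take.
move e : (bsub b s) => b'; elim: b' s e => [i j|f IH] s e /=.
  rewrite /mkpair /fleaf; case: ifP => oi; last by split=> [|[]]; [exists 0|].
  split=> [<-|[k]]; first by exists i./2.+1; rewrite size_pre nth_mkseq.
  by rewrite size_pre => -[lt]; rewrite nth_mkseq.
have e' n : bsub b (rcons s n) = f n by rewrite bsub_rcons e.
split=> [h|[k h] n].
  pose n := code s; pose t := rcons (gen (force_lab b) a n) (a n).
  have [_ hm] := gstepP (force_lab b) (decode n) t; rewrite CodeSeq.codeK in hm.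
  have gE : gstep (force_lab b) s t = pre x (size (gen (force_lab b) a n.+1)).
    by rewrite /x pre_phi /= CodeSeq.codeK.
  case: hm => [[h1|[m h1]]|h1].
  - exists (size (gen (force_lab b) a n.+1)); rewrite -gE.
    by move: h1; rewrite /force_lab e.
  - exfalso; apply: (h m); apply/(IH m _ (e' m)).
    exists (size (gen (force_lab b) a n.+1)); rewrite -gE.
    by move: h1; rewrite /force_lab e'.
  (* If no extension of [t] decides the node, then none forces a child, so by definition [t] forces
     the node. *)
  - exfalso; apply: (h1 t (prefix_refl t)); left; rewrite /force_lab e /= => m r tr fr.
    by apply: (h1 r tr); right; exists m; rewrite /force_lab e'.
move=> /(IH n _ (e' n))[l fl].
apply: (h n (pre x (maxn k l))); first exact/prex/leq_maxl.
by apply: force_mono fl; exact/prex/leq_maxr.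
Qed.

Lemma borel_map_generic (h : baire -> baire) : borel_map h -> exists b,
  continuous (fun a => h (mkpair (benc b) (phi (force_lab b) a))).
Proof.
move=> bh.
have /(_ _)/cid hb n : exists b, forall ij, @unpickle (nat * nat)%type n = Some ij ->
    forall p, h p ij.1 = ij.2 <-> beval b p.
  case e: unpickle => [[i j]|]; last by exists (bleaf 0 0).
  have [b hb] := borel_beval (borel_map_coord i [set j] bh).
  by exists b => _ [<-]; exact: hb.
(* The node collects the formulas for all statements [h p i = j] as children, so that one generic
   real serves them all. Each true one is forced by a finite prefix, whence continuity. *)
pose b := bnode (fun n => projT1 (hb n)); exists b.
have bE i j p : h p i = j <-> beval (bsub b [:: pickle (i, j)]) p.
  rewrite /b /= bsub_nil.
  by case: (hb _) => /= b' /(_ (i, j)); rewrite pickleK => /(_ erefl).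
apply: continuous_to_baire => i a; set j := h _ i.
have /(bE i j)/truth[k fk] : h (mkpair (benc b) (phi (force_lab b) a)) i = j by [].
apply/nbhs_baire; exists k => a' e; apply/bE; apply/truth; exists k.
by rewrite (@phi_local _ a' a k e).
Qed.

Lemma borel_labelling : borel [set cl : baire * baire | labelling cl.1 cl.2].
Proof.
have blab s t : borel [set cl : baire * baire | lab cl.2 s t].
  apply: (@borel_map_coord _ snd (pickle (s, t)) [set 1]).
  by apply: continuous_borel; cont.
have bc i j : borel [set cl : baire * baire | cl.1 i = j].
  apply: (@borel_map_coord _ fst i [set j]).
  by apply: continuous_borel; cont.
apply: borel_all => s; apply: borel_all => t; apply: borel_and.
  apply: borel_imp; first exact: bc.
  have bn : borel [set cl : baire * baire | forall n r, prefix t r -> ~ lab cl.2 (rcons s n) r].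
    apply: borel_all => n; apply: borel_all => r; apply: borel_imp; first exact: borel_cst.
    by apply: borel_not; exact: blab.
  by apply: borel_and; apply: borel_imp.
apply: borel_all => i; apply: borel_all => j; apply: borel_imp; first exact: bc.
have bf : borel [set cl : baire * baire | fleaf cl.1 i j t].
  by rewrite /fleaf; case: (odd i); [exact: borel_cst|exact: bc].
by apply: borel_and; apply: borel_imp.
Qed.

Lemma borel_phi : borel_map (fun la : baire * baire => phi (lab la.1) la.2).
Proof.
have blab s t : borel [set la : baire * baire | lab la.1 s t].
  apply: (@borel_map_coord _ fst (pickle (s, t)) [set 1]).
  by apply: continuous_borel; cont.
have bm s t : borel [set la : baire * baire | meets (lab la.1) s t].
  by apply: borel_or; [exact: blab|apply: borel_ex => m; exact: blab].
have bst s t r : borel [set la : baire * baire | gstep (lab la.1) s t = r].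
  rewrite (_ : mkset _ = [set la : baire * baire | exists k, least (fun a =>
    prefix t (decode a) /\ (meets (lab la.1) s (decode a) \/
      forall r, prefix t r -> ~ meets (lab la.1) s r)) = k /\ decode k = r]).
    apply: borel_ex => k; apply: borel_and; last exact: borel_cst.
    apply: (@borel_least _ (fun a (la : baire * baire) => prefix t (decode a) /\
      (meets (lab la.1) s (decode a) \/ forall r, prefix t r -> ~ meets (lab la.1) s r))) => m.
    apply: borel_and; first exact: borel_cst.
    apply: borel_or => //; apply: borel_all => r'; apply: borel_imp; first exact: borel_cst.
    exact: borel_not.
  apply/seteqP; split => la /=; last by move=> [k [<- <-]].
  by move=> <-; eexists; split; first by [].
have bg n t : borel [set la : baire * baire | gen (lab la.1) la.2 n = t].
  elim: n t => [|n IH] t; first exact: (@borel_cst _ ([::] = t)).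
  rewrite (_ : mkset _ = [set la : baire * baire | exists t' m,
    gen (lab la.1) la.2 n = t' /\ (la.2 n = m /\ gstep (lab la.1) (decode n) (rcons t' m) = t)]).
    apply: borel_ex => t'; apply: borel_ex => m; apply: borel_and; first exact: IH.
    apply: borel_and; last exact: bst.
    apply: (@borel_map_coord _ snd n [set m]).
    by apply: continuous_borel; cont.
  apply/seteqP; split => la /=; last by move=> [t' [m [<- [<- <-]]]].
  by move=> <-; exists (gen (lab la.1) la.2 n), (la.2 n).
apply: borel_map_baire => i j.
rewrite (_ : mkset _ = [set la : baire * baire | exists t,
  gen (lab la.1) la.2 i.+1 = t /\ nth 0 t i = j]).
  by apply: borel_ex => t; apply: borel_and; [exact: bg|exact: borel_cst].
by apply/seteqP; split => la /=; [move=> <-; eexists|move=> [t [<-]]].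
Qed.

(** The reduction of [C] to [C'] stays continuous after composition with any
    given Borel map [h]: the parameter carries a code for [h], and the real
    attached to it is generic for that code. *)
Lemma continuous_after_borel (R : realType) (V : topologicalType) (v0 : V)
    (iota : V -> baire) (C : set (V * baire)) :
  polish R V -> continuous iota -> injective iota -> cosusl C ->
  exists2 C' : set (baire * baire), cosusl C' &
    forall h : baire -> baire, borel_map h -> exists f : V -> baire,
      continuous (fun v => h (f v)) /\
      forall v, (exists w, C' (f v, w)) <-> exists y, C (v, y).
Proof.
move=> pV ci ii cC; have [q [e [cq _ qe]]] := polish_parametrization v0 pV.
have pbb := polish_prod (polish_baire R) (polish_baire R).
have cb n : continuous (bcol n) by exact: cont_reidx.
(* The witness has three columns: the labelling of the code, a name of the point [v] recovered from
   the generic real, and the witness for [C]. *)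
exists [set pw | (labelling (vev pw.1) (bcol 0 pw.2) /\
    podd pw.1 = phi (lab (bcol 0 pw.2)) (iota (q (bcol 1 pw.2)))) /\
    C (q (bcol 1 pw.2), bcol 2 pw.2)].
  apply: cosusl_and; last first.
    apply: (@cosusl_preim _ _ (fun pw : baire * baire => (q (bcol 1 pw.2), bcol 2 pw.2)) _ _ cC).
    by cont.
  apply: (borel_cosusl pbb); apply: borel_and.
    apply: (@continuous_borel _ _ (fun pw : baire * baire => (vev pw.1, bcol 0 pw.2)) _ _ borel_labelling).
    by rewrite /vev; cont.
  pose k pw : baire * baire := (podd pw.1, phi (lab (bcol 0 pw.2)) (iota (q (bcol 1 pw.2)))).
  have bk : borel_map k.
    apply: (borel_map_pair (polish_baire R) (polish_baire R)).
      by apply: continuous_borel; rewrite /podd; cont.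
    have cg : continuous (fun pw : baire * baire => (bcol 0 pw.2, iota (q (bcol 1 pw.2)))) by cont.
    exact: (borel_map_comp (continuous_borel cg) borel_phi).
  have bd : borel [set d : baire * baire | d.1 = d.2].
    by apply: borel_closed; apply: closed_eq_fun hausdorff_baire _ _; cont.
  exact: (bk _ bd).
move=> h /borel_map_generic[b cb'].
exists (fun v => mkpair (benc b) (phi (force_lab b) (iota v))); split.
  exact: (cont_comp cb' ci).
move=> v; split.
  move=> [w [[/=]]]; rewrite vev_mkpair podd_mkpair => /labelling_unique -> /phi_inj/ii -> Cw.
  by exists (bcol 2 w).
move=> [y Cy]; have [l hl el] := labelling_ex b.
exists (bglue (fun n => match n with 0 => l | 1 => e v | _ => y end)).
by rewrite /= !bcol_bglue vev_mkpair podd_mkpair qe el.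
Qed.

(** For each pair of basic open sets, a clopen set between them is chosen if there is one. These
    countably many clopen sets separate points, and their indicator functions are the
    coordinates. *)
Lemma clopen_embedding (R : realType) (V : topologicalType) : polish R V ->
  has_clopen_basis V -> exists2 iota : V -> baire, continuous iota & injective iota.
Proof.
move=> pV [bo bb]; have [U [oU bU]] := polish_base pV.
pose ok n m (W : set V) := clopen W /\ U n `<=` W /\ W `<=` U m.
pose W k : set V := if @unpickle (nat * nat)%type k is Some (n, m)
  then (if pselect (exists W, ok n m W) is left h then projT1 (cid h) else set0) else set0.
have cW k : clopen (W k).
  have c0 : clopen (@set0 V) by split; [exact: open0|exact: closed0].
  rewrite /W; case: unpickle => // -[n m]; case: pselect => // h.
  by case: cid => W0 [].
exists (fun v k => nat_of_bool `[< W k v >]).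
  apply: continuous_to_baire => k v; have [oW cl] := cW k.
  have [Wv|nWv] := pselect (W k v).
    have : nbhs v (W k) by exact: open_nbhs_nbhs.
    by apply: filterS => v' Wv'; congr nat_of_bool; apply/asboolP/asboolP.
  have : nbhs v (~` W k) by apply: open_nbhs_nbhs; split => //; exact: closed_openC.
  by apply: filterS => v' nWv'; congr nat_of_bool; apply/asboolP/asboolP.
move=> x y e; apply: contrapT => nxy.
have xy k : W k x <-> W k y.
  by have := congr1 (fun a : nat -> nat => a k) e; do 2 case: asboolP.
have := polish_hausdorff pV; rewrite open_hausdorff => /(_ x y (introN eqP nxy)).
move=> [[A B] /= [/set_mem Ax /set_mem By] [oA oB AB]].
have [m [Umx UmA]] := bU x A (open_nbhs_nbhs (conj oA Ax)).
have [W0 [cW0 W0x] W0U] := bb x (U m) (open_nbhs_nbhs (conj (oU m) Umx)).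
have [n [Unx UnW]] := bU x W0 (open_nbhs_nbhs (conj (bo _ cW0) W0x)).
have ex : exists W, ok n m W by exists W0.
have ok' : ok n m (W (pickle (n, m))).
  by rewrite /W pickleK; case: pselect => // h; case: cid.
have [_ [UW WU]] := ok'.
have /xy/WU/UmA Ay := UW x Unx.
by have : (A `&` B) y by []; rewrite (eqP AB).
Qed.

(** * Upper bound and hardness for the set of codes *)

Lemma hyperfinite_codes_sigma12 (R : realType) (K : borel_coding R) (X : topologicalType) :
  polish R X -> sigma12 R (hyperfinite_codes K X).
Proof.
move=> pX; have pXX := polish_prod pX pX.
have pbb := polish_prod (polish_baire R) (polish_baire R).
have [D [AD cD]] := cosusl_codedA K pX.
pose A c r := @codedA R K (X * X)%type (c, r).
have cb n : continuous (bcol n) by exact: cont_reidx.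
(* The existential real is a hyperfiniteness witness. Both inclusions between its union and the
   coded relation are coanalytic, with [A] in hypotheses and [D] in conclusions. *)
exists [set cw : baire * baire | (BC K (X * X)%type cw.1 /\ wit K X cw.2) /\
  forall r, (A cw.1 r -> exists n, D (bcol n cw.2, r)) /\
            forall n, A (bcol n cw.2) r -> D (cw.1, r)].
  apply: (susl_analytic pbb); apply: cosusl_and; first apply: cosusl_and.
  - by apply: (cosusl_BC K pX); cont.
  - by apply: (@cosusl_preim _ _ snd _ _ (cosusl_wit K pX)); cont.
  apply: (cosusl_all_polish pXX); apply: cosusl_and.
    apply: cosusl_imp; first by apply: (susl_codedA K pX); cont.
    by apply: cosusl_ex => n; apply: cD; cont.
  apply: cosusl_all => n; apply: cosusl_imp; first by apply: (susl_codedA K pX); cont.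
  by apply: cD; cont.
apply/seteqP; split => c.
  move=> [hc _ /(hyperfinite_wit K pX)[w ww hw]]; exists (c, w) => //=; split => // r.
  split=> [/hw[n An]|n An]; first by exists n; apply/AD => //; have [] := ww n.
  by apply/AD => //; apply/hw; exists n.
move=> [[c' w] /= [[hc ww] h] <-].
have hE r : coded K c' r <-> exists n, A (bcol n w) r.
  have [h1 h2] := h r; split=> [/h1[n Dn]|[n /h2 Dc]].
    by exists n; apply/AD => //; have [] := ww n.
  exact/AD.
have hyp := wit_hyperfinite ww hE.
by split => //; exact: hyperfinite_cber.
Qed.

Theorem theorem0p1 (R : realType) (K : borel_coding R)
    (union_problem_fails :
       exists (X : Type) (S : set_system X) (E : set (X * X)),
         [/\ standard_borel R S, cber S E, hyperhyperfinite S E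
           & ~ hyperfinite S E]) :
  (forall X : topologicalType, polish R X ->
     sigma12 R (hyperfinite_codes K X)) /\
  (exists2 X : topologicalType, polish R X &
     sigma12_hard R (hyperfinite_codes K X)).
Proof.
split; first exact: hyperfinite_codes_sigma12.
have [F [fF Fm FS nE]] := hyperfinite_transfer union_problem_fails.
have pX := polish_prod (polish_baire R) (polish_baire R).
exists (baire * baire)%type => // V pV zV B [C aC ->].
have [[v0 _]|nV] := pselect (exists v : V, True); last first.
  exists (fun _ => (fun _ => 0) : baire); first by move=> v; case: nV; exists v.
  by apply/seteqP; split => v; case: nV; exists v.
have [iota ci ii] := clopen_embedding pV zV.
have sC := analytic_susl (polish_prod pV (polish_baire R)) aC.
(* The order matters: [EE] is built from [C'] and the Borel map [h] from [EE], so [C'] has to be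
   fixed before [h] is known. *)
have [C' cC' hC'] := continuous_after_borel v0 pV ci ii sC.
have [EE bEE hEE] := sigma12_reduces K fF Fm FS nE cC'.
have [h bh hh] := codedA_sections K (polish_prod pX pX) (polish_baire R) bEE.
have [f [cf hf]] := hC' h bh.
exists (fun v => h (f v)) => //; apply/seteqP; split => v /=.
  have [_ e] := hh (f v).
  move=> [_ _]; rewrite /coded e => /hEE/hf[y Cy].
  by exists (v, y).
move=> [[v' y] Cy /= <-]; have [hB e] := hh (f v').
have hyp : hyperfinite (@borel (baire * baire)%type) (coded K (h (f v'))).
  by rewrite /coded e; apply/hEE; apply/hf; exists y.
by split => //; exact: hyperfinite_cber.
Qed.
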